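(* Assume the standing assumptions in the context, let $f\in AC(I)$, and suppose the finite limits $a_1:=\lim_{x\to x_0}f_1^*(x)$ and $a_2:=\lim_{x\to x_0}f_2^*(x)$ exist (i.e. the graph of $f$ admits $y=a_1\phi_1(x)+a_2\phi_2(x)$ as limit tangent curve in $\mathrm{span}(\phi_1,\phi_2)$). Put $\gamma:=\lim_{x\to x_0}F^*(x)$ (which exists) and $R(x):=f(x)-a_1\phi_1(x)-a_2\phi_2(x)$. (I) $R(x)=-\phi_1(x)\int_x^{x_0}W(t)\phi_1(t)^{-2}[f_2^*(t)-a_2]\,dt=-\phi_1(x)\int_x^{x_0}(\phi_2(t)/\phi_1(t))'[f_2^*(t)-a_2]\,dt$ for $x\in[T,x_0)$, and $R(x)=-\Phi(x)\int_x^{x_0}W(t)\Phi(t)^{-2}[F^*(t)-\gamma]\,dt$ for $x\in(T,x_0)$. If moreover $\phi_1,\phi_2\in AC^1(I)$ and $f\in AC^1(I)$, then $$R(x)=\phi_1(x)\int_x^{x_0}\Big(\frac{\phi_2(t)}{\phi_1(t)}\Big)'dt\int_t^{x_0}\phi_1(s)W(s)^{-1}L[f(s)]\,ds,\quad x\in[T,x_0),$$ $$R(x)=-\phi_2(x)\int_x^{x_0}\Big(\frac{\phi_1(t)}{\phi_2(t)}\Big)'dt\int_t^{x_0}\phi_2(s)W(s)^{-1}L[f(s)]\,ds,\quad x\in[T,x_0),$$ $$R(x)=\Phi(x)\int_x^{x_0}W(t)\Phi(t)^{-2}dt\int_t^{x_0}\Phi(s)W(s)^{-1}L[f(s)]\,ds,\quad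 x\in(T,x_0).$$ (II) For $x\in[T,x_0)$: $$|R(x)|\le|\phi_2(x)|\cdot\operatorname*{ess\,sup}_{x<t<x_0}|f_2^*(t)-a_2|,\qquad |R(x)|\le\Big|\frac{\phi_2(x)}{\phi_2(T)}\Big|\cdot\operatorname*{ess\,sup}_{x<t<x_0}|F^*(t)-\gamma|;$$ and if moreover $\phi_1,\phi_2,f\in AC^1(I)$, then $$|R(x)|\le|\phi_2(x)|\int_x^{x_0}\big|\phi_1(t)W(t)^{-1}L[f(t)]\big|\,dt,\quad x\in[T,x_0),$$ $$|R(x)|\le\Big|\frac{\phi_2(x)}{\phi_2(T)}\Big|\int_x^{x_0}\big|\Phi(t)W(t)^{-1}L[f(t)]\big|\,dt,\quad x\in(T,x_0).$$ (III) If $f\in C^1(I)$, then for each $x\in[T,x_0)$ there exists $\xi_1\in[x,x_0]$ (in the extended reals) with $R(x)=\phi_2(x)\,(f_2^*(\xi_1)-a_2)$, where $f_2^*(x_0):=a_2$; and for each $x\in(T,x_0)$ there exists $\xi_2\in[x,x_0]$ with $R(x)=\frac{\phi_2(x)}{\phi_2(T)}(F^*(\xi_2)-\gamma)$, where $F^*(x_0):=\gamma$. If moreover $\phi_1,\phi_2,f\in AC^1(I)$, these read, for $x\in(T,x_0)$, $$R(x)=-\phi_2(x)\int_{\xi_1}^{x_0}\phi_1(t)W(t)^{-1}L[f(t)]\,dt,\qquad R(x)=-\frac{\phi_2(x)}{\phi_2(T)}\int_{\xi_2}^{x_0}\Phi(t)W(t)^{-1}L[f(t)]\,dt,$$ with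 the convention $\int_{x_0}^{x_0}=0$.
   Context: Let $x_0\in\mathbb{R}\cup\{+\infty\}$, $T\in\mathbb{R}$ with $T<x_0$, and $I:=[T,x_0)$. Limits as $x\to x_0$ are taken for $x\in I$ (over points where the functions are defined). For differentiable $g,h$ put $W(g,h;x):=g(x)h'(x)-g'(x)h(x)$. Standing assumptions: $\phi_1,\phi_2\in C^1(I)$; $\phi_2(x)=o(\phi_1(x))$ as $x\to x_0$; $\phi_1(x)\neq0$, $\phi_2(x)\neq0$ for all $x\in I$; $W(x):=W(\phi_1,\phi_2;x)\neq0$ for all $x\in I$. $AC(I)$: absolutely continuous on every compact subinterval of $I$; $AC^1(I)$: $C^1$ functions whose derivative is in $AC(I)$. For $f\in AC(I)$ and $t$ where $f$ is differentiable: $f_1^*(t):=W(f,\phi_2;t)/W(t)$, $f_2^*(t):=-W(f,\phi_1;t)/W(t)$; $\Phi(x):=\phi_2(T)\phi_1(x)-\phi_1(T)\phi_2(x)$; $F^*(t):=\phi_1(T)f_1^*(t)+\phi_2(T)f_2^*(t)=W(\Phi,f;t)/W(t)$. When $\phi_1,\phi_2\in AC^1(I)$, $L$ is the unique operator $L[u]=u''+a_1(x)u'+a_2(x)u$ ($a_i$ locally integrable) with kernel $\mathrm{span}(\phi_1,\phi_2)$; equivalently $L[u]=\frac{W}{\phi_1}\big[\frac{\phi_1^2}{W}(u/\phi_1)'\big]'$. *)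

(* Defs.v *)
From HB Require Import structures.
From mathcomp Require Import all_boot all_order all_algebra.
From mathcomp Require Import all_classical all_reals all_analysis ess_sup_inf.
Set Implicit Arguments. Unset Strict Implicit. Unset Printing Implicit Defensive.
Import Order.TTheory GRing.Theory Num.Theory.
Import numFieldNormedType.Exports.
Local Open Scope classical_set_scope.
Local Open Scope ring_scope.

Section defs.
Variable R : realType.
Implicit Types (a b : R) (f g : R -> R).

Definition Iset (T : R) (x0 : \bar R) : set R := [set x | T <= x /\ (x%:E < x0)%E].

Definition toward (x0 : \bar R) : set_system R :=
  match x0 with
  | r%:E => at_left r
  | +oo%E => pinfty_nbhs R
  | -oo%E => ninfty_nbhs R
  end.

Global Instance toward_filter (x0 : \bar R) : Filter (toward x0).
Proof. by case: x0 => [r||] /=; typeclasses eauto. Qed.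
Definition towardF (x0 : \bar R) : filter_on R := FilterType (toward x0) (toward_filter x0).

(* derivative relative to I (one-sided at the endpoint T) *)
Definition Ifilt (T : R) (x0 : \bar R) (x : R) : set_system R :=
  within (fun h : R => h != 0 /\ Iset T x0 (h + x)) (nbhs (0 : R)).
Definition dq f (x : R) : R -> R := fun h => h^-1 * (f (h + x) - f x).
Definition ddiff (T : R) (x0 : \bar R) f (x : R) : Prop := cvg (dq f x @ Ifilt T x0 x).
Definition dI (T : R) (x0 : \bar R) f (x : R) : R := lim (dq f x @ Ifilt T x0 x).

Definition C1on (T : R) (x0 : \bar R) f : Prop :=
  (forall x, Iset T x0 x -> ddiff T x0 f x) /\
  {within Iset T x0, continuous dI T x0 f}.

Definition AC_on a b f : Prop :=
  forall e : R, 0 < e -> exists2 d : R, 0 < d &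
    forall (n : nat) (s : 'I_n -> R * R),
      (forall i, a <= (s i).1 /\ (s i).1 <= (s i).2 /\ (s i).2 <= b) ->
      (forall i j, i != j -> (s i).2 <= (s j).1 \/ (s j).2 <= (s i).1) ->
      \sum_(i < n) ((s i).2 - (s i).1) < d ->
      \sum_(i < n) `|f (s i).2 - f (s i).1| < e.

Definition ACon (T : R) (x0 : \bar R) f : Prop :=
  forall a b, Iset T x0 a -> Iset T x0 b -> a <= b -> AC_on a b f.

Definition AC1on (T : R) (x0 : \bar R) f : Prop := C1on T x0 f /\ ACon T x0 (dI T x0 f).

Definition Wr (T : R) (x0 : \bar R) g h (x : R) : R := g x * dI T x0 h x - dI T x0 g x * h x.

Definition Df (T : R) (x0 : \bar R) f : set R := [set t | Iset T x0 t /\ ddiff T x0 f t].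

Definition f1s (T : R) (x0 : \bar R) (p1 p2 f : R -> R) (t : R) : R :=
  Wr T x0 f p2 t / Wr T x0 p1 p2 t.
Definition f2s (T : R) (x0 : \bar R) (p1 p2 f : R -> R) (t : R) : R :=
  - Wr T x0 f p1 t / Wr T x0 p1 p2 t.
Definition Fs (T : R) (x0 : \bar R) (p1 p2 f : R -> R) (t : R) : R :=
  p1 T * f1s T x0 p1 p2 f t + p2 T * f2s T x0 p1 p2 f t.
Definition Phi T (p1 p2 : R -> R) (x : R) : R := p2 T * p1 x - p1 T * p2 x.

Definition Lop (T : R) (x0 : \bar R) (p1 p2 u : R -> R) (s : R) : R :=
  Wr T x0 p1 p2 s / p1 s *
  dI T x0 (fun t => p1 t ^+ 2 / Wr T x0 p1 p2 t *
                    dI T x0 (fun r => u r / p1 r) t) s.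

Definition partial_int g a (y : R) : R :=
  Rintegral lebesgue_measure [set t | a <= t <= y] g.
Definition iint_ex (x0 : \bar R) g a : Prop :=
  (forall y, a <= y -> (y%:E < x0)%E ->
     lebesgue_measure.-integrable [set t | a <= t <= y] (EFin \o g)) /\
  cvg (partial_int g a @ toward x0).
Definition iint (x0 : \bar R) g a : R := lim (partial_int g a @ toward x0).

Definition ext_val (x0 : \bar R) (h : R -> R) (dflt : R) (xi : \bar R) : R :=
  match xi with
  | r%:E => if (r%:E < x0)%E then h r else dflt
  | _ => dflt
  end.

End defs.

(* Main.v *)
Require Import Defs.
From HB Require Import structures.
From mathcomp Require Import all_boot all_order all_algebra.
From mathcomp Require Import all_classical all_reals all_analysis ess_sup_inf.
From mathcomp Require Import measurable_realfun ring lra.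

(* Since f = f1* phi1 + f2* phi2 almost everywhere, the quotient of the remainder
   f - a1 phi1 - a2 phi2 by any combination p = u phi1 + v phi2 has derivative
   W / p^2 * (u (f2* - a2) - v (f1* - a1)), while the quotient q / p of two combinations
   has derivative a constant multiple of W / p^2, which has constant sign.  For
   p = phi1 the quotient tends to 0 at x0, because it does so along the points where f is
   differentiable; integrating gives (I), comparing the derivatives of remainder / p and
   q / p gives (II), and Rolle's theorem on [x, x0) gives (III).  The estimate (II) yields
   remainder / phi2 -> 0, whence the same statements for p = phi2 and p = Phi.  When the
   data are AC^1, p / W L[f] is the derivative of u f2* - v f1* by variation of constants.

   What is needed from real analysis is the fundamental theorem of calculus for absolutely
   continuous functions: such a function is a difference of monotone ones, whose
   Lebesgue-Stieltjes measures are dominated by Lebesgue measure; the Radon-Nikodym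
   density is then the derivative by Lebesgue's differentiation theorem. *)

Set Implicit Arguments. Unset Strict Implicit. Unset Printing Implicit Defensive.
Import Order.TTheory GRing.Theory Num.Theory.
Import numFieldNormedType.Exports.
Local Open Scope classical_set_scope.
Local Open Scope ring_scope.

(** * Absolutely continuous functions *)

Section absolute_continuity.
Context {R : realType}.
Implicit Types (a b c : R) (f g h : R -> R) (p q : R * R).

(** For f merely in AC(I), f1* and f2* are meaningful only where f is differentiable, and their
    limits are taken along that set. Quotients of the remainder are continuous, so a limit along
    this dense set extends to all of I. The improper integrals may converge only conditionally: each
    is evaluated through a primitive with a known limit at x0. The essential-supremum bounds are
    therefore obtained from monotonicity and not by estimating an integral. Two denominators are
    delicate. Since phi1/phi2 is unbounded near x0, the limit of remainder/phi2 cannot be read off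
    the decomposition of f. Since Phi vanishes at T, its estimate is proved on (T, x0) and carried
    to T by continuity. The numerator q is normalised by determinant 1 against p and by q/p -> 0.
    This forces q = phi2 for p = phi1 and q = phi2/phi2(T) for p = Phi, whence the factor
    phi2(x)/phi2(T) in the second halves of (II) and (III). *)

Definition subseg a b p := (a <= p.1) && ((p.1 <= p.2) && (p.2 <= b)).
Definition nonoverlap p q := (p.2 <= q.1) || (q.2 <= p.1).

Lemma nonoverlapC : symmetric nonoverlap.
Proof. by move=> p q; rewrite /nonoverlap orbC. Qed.

(** Lists instead of families indexed by ['I_n]: subdividing a segment becomes a concatenation,
    which suits induction. *)
Definition small_osc a b f (e d : R) := forall s : seq (R * R),
  all (subseg a b) s -> pairwise nonoverlap s ->
  \sum_(p <- s) (p.2 - p.1) < d -> \sum_(p <- s) `|f p.2 - f p.1| < e.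

Lemma AC_onP a b f : AC_on a b f <->
  forall e : R, 0 < e -> exists2 d : R, 0 < d & small_osc a b f e d.
Proof.
split=> H e e0; have [d d0 D] := H e e0; exists d => //.
  move=> s /(all_nthP (0, 0)) sab /(pairwiseP (0, 0)) sno.
  rewrite !(big_nth (0, 0)) !big_mkord.
  apply: (D (size s) (fun i => nth (0, 0) s i)).
    by move=> i; have /andP[-> /andP[-> ->]] := sab i (ltn_ord i).
  move=> i j; rewrite neq_lt => /orP[] ij.
    by apply/orP; exact: (sno i j (ltn_ord i) (ltn_ord j) ij).
  apply/orP; rewrite orbC; apply: (sno j i (ltn_ord j) (ltn_ord i) ij).
move=> n s sab sno.
have sumE (F : R * R -> R) :
    \sum_(p <- [seq s i | i <- enum 'I_n]) F p = \sum_(i < n) F (s i).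
  by rewrite big_map big_enum.
have := D [seq s i | i <- enum 'I_n]; rewrite !sumE; apply.
  by apply/allP => p /mapP[i _ ->]; have [? [? ?]] := sab i; apply/and3P.
rewrite pairwise_map; have := enum_uniq 'I_n.
rewrite uniq_pairwise; apply: sub_pairwise => i j ij.
by apply/orP; exact: sno.
Qed.

(** Common source of the closure properties below: each only has to bound an increment of [h] by
    increments of [f] and [g]. *)
Lemma AC_on_dominated a b f g h (C : R) : 0 < C ->
  (forall x y, a <= x -> x <= y -> y <= b ->
     `|h y - h x| <= C * (`|f y - f x| + `|g y - g x|)) ->
  AC_on a b f -> AC_on a b g -> AC_on a b h.
Proof.
move=> C0 hfg acf acg e e0.
have e'0 : 0 < e / C / 2 by rewrite !divr_gt0.
have [d1 d10 D1] := acf _ e'0; have [d2 d20 D2] := acg _ e'0.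
exists (Num.min d1 d2); first by rewrite lt_min d10.
move=> n s sab sno; rewrite lt_min => /andP[sd1 sd2].
have S1 := D1 n s sab sno sd1; have S2 := D2 n s sab sno sd2.
apply: (@le_lt_trans _ _ (C * (\sum_(i < n) `|f (s i).2 - f (s i).1| +
                        \sum_(i < n) `|g (s i).2 - g (s i).1|))).
  rewrite -big_split /= mulr_sumr; apply: ler_sum => i _.
  by have [? [? ?]] := sab i; exact: hfg.
have -> : e = C * (e / C / 2 + e / C / 2) by field; rewrite gt_eqF.
by rewrite ltr_pM2l// ltrD.
Qed.

Lemma AC_on_sub a b a' b' f : a <= a' -> b' <= b -> AC_on a b f -> AC_on a' b' f.
Proof.
move=> aa bb acf e /acf[d d0 D]; exists d => // n s sab; apply: D => i.
by have [h1 [h2 h3]] := sab i; split; [lra|split; [lra|lra]].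
Qed.

Lemma AC_on_eq a b f g : (forall x, a <= x -> x <= b -> f x = g x) ->
  AC_on a b f -> AC_on a b g.
Proof.
move=> fg acf e /acf[d d0 D]; exists d => // n s sab sno sd.
rewrite (eq_bigr (fun i => `|f (s i).2 - f (s i).1|)); first exact: D.
by move=> i _; have [h1 [h2 h3]] := sab i; rewrite !fg//; lra.
Qed.

Lemma AC_on_Lipschitz a b f (C : R) :
  (forall x y, a <= x -> x <= y -> y <= b -> `|f y - f x| <= C * (y - x)) ->
  AC_on a b f.
Proof.
move=> fC; have ac_id : AC_on a b id.
  move=> e e0; exists e => // n s sab _; apply: le_lt_trans.
  by apply: ler_sum => i _; have [? [? ?]] := sab i; rewrite ger0_norm// subr_ge0.
(* [C] may be zero or negative, whereas the domination constant must be positive. *)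
apply: (@AC_on_dominated _ _ id id f (`|C| + 1)) => // x y ax xy yb.
have v0 : 0 <= y - x by rewrite subr_ge0.
rewrite (le_trans (fC _ _ ax xy yb))//= (ger0_norm v0).
have := ler_norm C; have := normr_ge0 C; nra.
Qed.

Lemma AC_onD a b f g : AC_on a b f -> AC_on a b g -> AC_on a b (f \+ g).
Proof.
apply: (@AC_on_dominated _ _ _ _ _ 1) => // x y _ _ _ /=.
by rewrite mul1r (le_trans _ (ler_normD _ _))// opprD addrACA.
Qed.

Lemma AC_onZ a b f c : AC_on a b f -> AC_on a b (fun x => c * f x).
Proof.
move=> acf; apply: (@AC_on_dominated _ _ f f _ (`|c| + 1)) => //.
move=> x y _ _ _; rewrite -mulrBr normrM.
have := normr_ge0 c; have := normr_ge0 (f y - f x).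
set u := `|c|; set v := `|_|; nra.
Qed.

Lemma AC_onB a b f g : AC_on a b f -> AC_on a b g -> AC_on a b (f \- g).
Proof.
move=> acf acg; apply: (AC_on_eq (f := f \+ (fun x => -1 * g x))).
  by move=> x _ _ /=; rewrite mulN1r.
exact/AC_onD/AC_onZ.
Qed.

Lemma AC_on_unif a b f (e : R) : AC_on a b f -> 0 < e -> exists2 d : R, 0 < d &
  forall x y, a <= x -> x <= b -> a <= y -> y <= b -> `|y - x| < d -> `|f y - f x| < e.
Proof.
move=> acf e0; have [d d0 D] := acf e e0; exists d => //.
suff H x y : a <= x -> x <= y -> y <= b -> `|y - x| < d -> `|f y - f x| < e.
  move=> x y ax xb ay yb; have [xy|/ltW yx] := leP x y; first exact: H.
  by rewrite distrC (distrC (f y)); exact: H.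
move=> ax xy yb; rewrite ger0_norm ?subr_ge0// => yxd.
have := D 1%N (fun=> (x, y)); rewrite !big_ord1 /=; apply => //.
by move=> i j; rewrite (ord1 i) (ord1 j) eqxx.
Qed.

Lemma AC_on_continuous a b f : AC_on a b f -> {within `[a, b], continuous f}.
Proof.
move=> acf; apply/subspace_continuousP => x; rewrite /= in_itv/= => /andP[ax xb].
apply/cvgrPdist_lt => e e0; have [d d0 D] := AC_on_unif acf e0.
rewrite near_withinE; exists d => //= y; rewrite /= distrC => yxd.
by rewrite in_itv/= => /andP[ay yb]; rewrite distrC; exact: D.
Qed.

Lemma AC_on_bounded a b f : AC_on a b f -> exists2 M : R, 0 < M &
  forall x, a <= x -> x <= b -> `|f x| <= M.
Proof.
move=> acf; have [ab|ba] := leP a b; last first.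
  by exists 1 => // x ax xb; lra.
have /compact_bounded[N [Nr HN]] :=
  continuous_compact (AC_on_continuous acf) (@segment_compact _ a b).
exists (`|N| + 1); first by rewrite ltr_wpDl.
move=> x ax xb; apply: (HN (`|N| + 1)); last first.
  by exists x => //=; rewrite in_itv/= ax.
by rewrite (le_lt_trans (ler_norm N))// ltrDl.
Qed.

Lemma AC_onM a b f g : AC_on a b f -> AC_on a b g -> AC_on a b (f \* g).
Proof.
move=> acf acg; have [M M0 HM] := AC_on_bounded acf.
have [N N0 HN] := AC_on_bounded acg.
apply: (@AC_on_dominated _ _ f g _ (M + N)) => //; first by lra.
move=> x y ax xy yb /=.
have -> : f y * g y - f x * g x = (f y - f x) * g y + f x * (g y - g x) by ring.
rewrite (le_trans (ler_normD _ _))// !normrM.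
have := HN y (le_trans ax xy) yb; have := HM x ax (le_trans xy yb).
have := normr_ge0 (f x); have := normr_ge0 (g y).
have := normr_ge0 (f y - f x); have := normr_ge0 (g y - g x).
set u := `|f x|; set v := `|g y|; set s := `|_ - _|; set t := `|_ - _|.
nra.
Qed.

(** The inverse is continuous on a compact segment, hence bounded by some [K]; an increment of 1/f
    is that of f times two such inverses, which gives the constant [K ^+ 2]. *)
Lemma AC_onV a b f : (forall x, a <= x -> x <= b -> f x != 0) ->
  AC_on a b f -> AC_on a b (fun x => (f x)^-1).
Proof.
move=> f0 acf; have [ab|ba] := leP a b; last first.
  move=> e e0; exists 1 => // n s sab _ _; rewrite big1 // => i _.
  by have [? [? ?]] := sab i; lra.
have cfV : {within `[a, b], continuous (fun x => (f x)^-1)}.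
  apply/subspace_continuousP => x xab; apply: cvgV.
    by move: xab; rewrite /= in_itv/= => /andP[ax xb]; exact: f0.
  by have /subspace_continuousP := AC_on_continuous acf; exact.
have /compact_bounded[N [Nr HN]] := continuous_compact cfV (@segment_compact _ a b).
pose K := `|N| + 1; have K0 : 0 < K by rewrite ltr_wpDl.
have HK x : a <= x -> x <= b -> `|(f x)^-1| <= K.
  move=> ax xb; apply: (HN K); last by exists x => //=; rewrite in_itv/= ax.
  by rewrite (le_lt_trans (ler_norm N))// ltrDl.
apply: (@AC_on_dominated _ _ f f _ (K ^+ 2)) => //; first by rewrite exprn_gt0.
move=> x y ax xy yb.
have fx := f0 x ax (le_trans xy yb); have fy := f0 y (le_trans ax xy) yb.
have -> : (f y)^-1 - (f x)^-1 = - (f y - f x) * ((f y)^-1 * (f x)^-1).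
  by field; rewrite fx fy.
rewrite normrM normrN normrM.
have := HK x ax (le_trans xy yb); have := HK y (le_trans ax xy) yb.
have := normr_ge0 (f y - f x); have := normr_ge0 (f x)^-1; have := normr_ge0 (f y)^-1.
set u := `|(f x)^-1|; set v := `|(f y)^-1|; set t := `|_ - _| => v0 u0 t0 vK uK.
have : v * u <= K ^+ 2 by rewrite expr2 ler_pM.
nra.
Qed.

End absolute_continuity.

(** * Total variation of absolutely continuous functions and the Jordan decomposition *)

Section total_variation_AC.
Context {R : realType}.
Implicit Types (a b : R) (f : R -> R) (s t : seq (R * R)) (l : seq R).

Fixpoint steps a l := if l is x :: l' then (a, x) :: steps x l' else [::].

Lemma variation_steps a b f l : itv_partition a b l ->
  variation a b f l = \sum_(p <- steps a l) `|f p.2 - f p.1|.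
Proof.
move/variation_zip => ->; elim: l a => [a|x l ih a] /=; first by rewrite !big_nil.
by rewrite !big_cons /= ih.
Qed.

Lemma sum_len_steps a l : \sum_(p <- steps a l) (p.2 - p.1) = last a l - a.
Proof.
elim: l a => [a|x l ih a] /=; first by rewrite big_nil subrr.
by rewrite big_cons ih /=; ring.
Qed.

Lemma subseg_steps a l : path <%R a l -> all (subseg a (last a l)) (steps a l).
Proof.
elim: l a => //= x l ih a /andP[ax xl].
have xle : x <= last x l.
  by apply: (@itv_partition_le _ _ x (last x l) l); split.
rewrite {1}/subseg/= lexx (ltW ax) xle /=.
apply: sub_all (ih x xl) => p /and3P[h1 h2 h3]; apply/and3P; split=> //.
by rewrite (le_trans (ltW ax)).
Qed.

Lemma nonoverlap_steps a l : path <%R a l -> pairwise nonoverlap (steps a l).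
Proof.
elim: l a => //= x l ih a /andP[ax xl]; rewrite ih// andbT.
apply: sub_all (subseg_steps xl) => p /and3P[h1 h2 h3].
by rewrite /nonoverlap/= h1.
Qed.

Lemma nonoverlap_subseg a b p (q : R * R) : subseg a b p ->
  nonoverlap (a, b) q -> nonoverlap p q.
Proof.
by move=> /and3P[h1 h2 h3] /orP[] /= h; apply/orP; [left|right]; lra.
Qed.

(* Each total variation is a supremum over partitions; refining the segments of [s] one
   at a time moves them to the list [t] of segments already subdivided. *)
Lemma small_osc_TV a b f e d : small_osc a b f e d -> forall s t,
  all (subseg a b) (s ++ t) -> pairwise nonoverlap (s ++ t) ->
  \sum_(p <- s ++ t) (p.2 - p.1) < d ->
  (\sum_(p <- s) total_variation p.1 p.2 f +
   (\sum_(p <- t) `|f p.2 - f p.1|)%:E <= e%:E)%E.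
Proof.
move=> H; elim=> [t sab sno sd|p s ih t]; first by rewrite big_nil add0e lee_fin ltW// H.
rewrite !cat_cons big_cons /= => /andP[pab sab] /andP[pno sno] sd.
have /and3P[ap p12 pb] := pab.
have TV0 : (0 <= \sum_(q <- s) total_variation q.1 q.2 f)%E.
  rewrite big_seq; apply: sume_ge0 => q qs; apply: total_variation_ge0.
  by move: sab; rewrite all_cat => /andP[/allP /(_ q qs) /and3P[]].
have := ih t sab sno _; have -> : \sum_(q <- s ++ t) (q.2 - q.1) < d.
  by apply: le_lt_trans sd; rewrite lerDr subr_ge0.
move=> /(_ isT).
set S := (\sum_(q <- s) _)%E in TV0 *; set V := \sum_(q <- t) _ => SVe.
have V0 : 0 <= V by exact: sumr_ge0.
have Sfin : S \is a fin_num.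
  rewrite ge0_fin_numE// (le_lt_trans _ (ltry e))// (le_trans _ SVe)//.
  by rewrite leeDl// lee_fin.
(* With the finite remaining terms moved to the right, the supremum for [p] is bounded partition by
   partition; the induction hypothesis is used with [steps p.1 l] added to [t]. *)
rewrite big_cons -addeA -/S -leeBrDr ?fin_numD ?Sfin//.
apply: ge_ereal_sup => _ /= [_ [l pl <-] <-].
rewrite leeBrDr ?fin_numD ?Sfin// (variation_steps _ pl).
have := ih (steps p.1 l ++ t).
rewrite [\sum_(q <- steps _ _ ++ _) _]big_cat/= EFinD addeCA; apply.
- move: sab; rewrite !all_cat => /andP[-> ->] /=; rewrite andbT.
  case: pl => /subseg_steps + /eqP lp; rewrite lp.
  apply: sub_all => q /and3P[h1 h2 h3]; apply/and3P; split => //.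
    by rewrite (le_trans ap).
  by rewrite (le_trans h3).
- move: sno pno; rewrite !pairwise_cat !all_cat => /and3P[st ss tt] /andP[ps pt].
  case: (pl) => pp /eqP lp; rewrite nonoverlap_steps// ss tt !andbT /=.
  have stp : {in steps p.1 l, forall q, subseg p.1 p.2 q}.
    by rewrite -lp; apply/allP; exact: subseg_steps.
  have nop (q u : R * R) : q \in steps p.1 l -> nonoverlap p u -> nonoverlap q u.
    by move=> /stp; case: (p) => ? ?; exact: nonoverlap_subseg.
  apply/andP; split.
    rewrite allrel_catr st andbT; apply/allrelP => q u qs us.
    by rewrite nonoverlapC; apply: nop => //; exact: (allP ps).
  by apply/allrelP => q u qs ut; apply: nop => //; exact: (allP pt).
- rewrite !big_cat/= sum_len_steps; case: pl => _ /eqP ->.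
  by move: sd; rewrite big_cat/=; lra.
Qed.

(** Segments shorter than the [d] belonging to e = 1 have variation at most 1. Finitely many steps
    of length [d / 2], which is strictly below [d], reach [b]. *)
Lemma AC_on_BV a b f : a <= b -> AC_on a b f -> total_variation a b f \is a fin_num.
Proof.
move=> ab /AC_onP /(_ 1 ltr01)[d d0 /small_osc_TV D].
have tv x y : a <= x -> x <= y -> y <= b -> y - x < d ->
    total_variation x y f \is a fin_num.
  move=> ax xy yb xyd; rewrite ge0_fin_numE ?total_variation_ge0//.
  have := D [:: (x, y)] [::]; rewrite /= !big_cons !big_nil /= addr0 !adde0.
  by rewrite /subseg/= ax xy yb => /(_ isT isT xyd) /le_lt_trans -> //; rewrite ltry.
have [n nd] : exists n : nat, b - a < d / 2 * n%:R.
  exists (Num.bound ((b - a) / (d / 2))).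
  rewrite mulrC -ltr_pdivrMr ?divr_gt0// archi_boundP//.
  by rewrite divr_ge0 ?subr_ge0// ltW// divr_gt0.
suff : forall k y, a <= y -> y <= b -> y - a <= d / 2 * k%:R ->
    total_variation a y f \is a fin_num.
  by apply; [exact: ab|exact: lexx|exact: ltW nd].
elim=> [y ay yb|k ih y ay yb].
  rewrite mulr0 => ya; have -> : y = a by lra.
  by rewrite total_variationxx.
rewrite -[k.+1%:R]natr1 => yk; have [ya|ya] := leP (y - d / 2) a.
  by apply: tv => //; lra.
rewrite (@total_variationD _ a y (y - d / 2)); [|lra|lra].
by rewrite fin_numD ih; [apply: tv; lra|lra..].
Qed.

Lemma AC_on_TV a b f : a <= b -> AC_on a b f ->
  AC_on a b (fine \o total_variation a ^~ f).
Proof.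
move=> ab acf; apply/AC_onP => e e0.
(* Passing to suprema in [small_osc_TV] leaves only a weak inequality, so half of [e] is
   requested. *)
have e20 : 0 < e / 2 by rewrite divr_gt0.
have /AC_onP/(_ _ e20)[d d0 /small_osc_TV D] := acf.
exists d => // s sab sno sd.
have := D s [::]; rewrite cats0 big_nil adde0 => /(_ sab sno sd) H.
apply: (@le_lt_trans _ _ (e / 2)); last by lra.
rewrite -lee_fin (le_trans _ H)// -sumEFin big_seq [leRHS]big_seq.
apply: lee_sum => p ps; have /and3P[h1 h2 h3] := allP sab p ps.
have fina x : a <= x -> x <= b -> total_variation a x f \is a fin_num.
  by move=> ax xb; apply: AC_on_BV => //; apply: AC_on_sub acf.
rewrite /= -fineB ?fina//; [|lra..].
rewrite (@total_variationD _ a p.2 p.1 f)// [X in fine X](_ : _ = total_variation p.1 p.2 f).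
  have tvfin : total_variation p.1 p.2 f \is a fin_num.
    by apply: AC_on_BV => //; apply: AC_on_sub acf.
  by rewrite ger0_norm ?fineK// fine_ge0// total_variation_ge0.
rewrite addeAC subee ?add0e// fina//; lra.
Qed.

(** Jordan decomposition: [u] is the variation from [a], and [u - f] is nondecreasing because
    increments of [u] dominate those of [f] in absolute value. *)
Lemma AC_on_monotone_decomp a b f : a <= b -> AC_on a b f ->
  exists u v : R -> R, [/\ AC_on a b u, AC_on a b v,
    {in `[a, b] &, nondecreasing_fun u}, {in `[a, b] &, nondecreasing_fun v} &
    forall x, f x = u x - v x].
Proof.
move=> ab acf; pose u : R -> R := fine \o total_variation a ^~ f.
have acu : AC_on a b u by exact: AC_on_TV.
have fina x y : a <= x -> x <= y -> y <= b -> total_variation x y f \is a fin_num.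
  by move=> ax xy yb; apply: AC_on_BV => //; apply: AC_on_sub acf.
have uge x y : a <= x -> x <= y -> y <= b -> `|f y - f x| <= u y - u x.
  move=> ax xy yb; rewrite /u /= -fineB; [|apply: fina; lra..].
  rewrite (@total_variationD _ a y x f)// addeAC subee ?add0e; last by apply: fina; lra.
  rewrite -lee_fin fineK; last exact: fina.
  exact: total_variation_ge.
exists u, (u \- f); split => //.
- exact: AC_onB.
- move=> x y; rewrite !in_itv/= => /andP[ax _] /andP[_ yb] xy.
  by have := uge x y ax xy yb; have := normr_ge0 (f y - f x); lra.
- move=> x y; rewrite !in_itv/= => /andP[ax _] /andP[_ yb] xy /=.
  by have := uge x y ax xy yb; have := ler_norm (f y - f x); lra.
- by move=> x /=; rewrite opprB addrCA subrr addr0.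
Qed.

End total_variation_AC.

(** * The fundamental theorem of calculus *)

Section AC_density.
Context {R : realType}.
Implicit Types (a b : R) (f g : R -> R).
Local Notation mu := (@lebesgue_measure R).

(** Retraction onto [a, b]. Composing with it extends a function from the segment to the whole line
    by constants, preserving continuity and monotonicity. *)
Definition clamp a b x := Num.max a (Num.min x b).

Variant clamp_spec a b x : R -> Type :=
  | ClampLeft of x <= a : clamp_spec a b x a
  | ClampIn of a <= x & x <= b : clamp_spec a b x x
  | ClampRight of b <= x : clamp_spec a b x b.

Lemma clampP a b x : a <= b -> clamp_spec a b x (clamp a b x).
Proof.
move=> ab; rewrite /clamp; have [xa|ax] := leP x a.
  rewrite (min_idPl (le_trans xa ab)) (max_idPl xa); exact: ClampLeft.
have [xb|bx] := leP x b; first by rewrite (max_idPr (ltW ax)); apply: ClampIn => //; exact: ltW.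
by rewrite (max_idPr ab); apply: ClampRight; exact: ltW.
Qed.

Lemma clamp_id a b x : a <= x -> x <= b -> clamp a b x = x.
Proof. by move=> ax xb; rewrite /clamp (min_idPl xb) (max_idPr ax). Qed.

Lemma clamp_itv a b x : a <= b -> a <= clamp a b x /\ clamp a b x <= b.
Proof. by move=> ab; case: clampP => //; lra. Qed.

Lemma clamp_nondecreasing a b : a <= b -> nondecreasing (clamp a b).
Proof. by move=> ab x y xy; do 2!case: clampP => // *; lra. Qed.

Lemma clamp_Lipschitz a b x y : a <= b -> `|clamp a b x - clamp a b y| <= `|x - y|.
Proof.
move=> ab; wlog xy : x y / x <= y.
  by move=> h; have [/h//|/ltW/h] := leP x y; rewrite distrC (distrC y).
have cxy : clamp a b x <= clamp a b y by exact: clamp_nondecreasing.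
rewrite (ler0_norm (_ : x - y <= 0)) ?subr_le0// ler0_norm ?subr_le0//.
do 2!case: clampP => // *; lra.
Qed.

Lemma clamp_continuous a b f : a <= b -> {within `[a, b], continuous f} ->
  continuous (f \o clamp a b).
Proof.
move=> ab /subspace_continuousP cf x; have [ax xb] := clamp_itv x ab.
have cx : `[a, b]%classic (clamp a b x) by rewrite /= in_itv/= ax.
have /cvgrPdist_lt H := cf _ cx; apply/cvgrPdist_lt => e e0.
have := H e e0.
rewrite near_withinE => -[d /= d0 D]; exists d => //= y xyd.
apply: D; last by rewrite /= in_itv/=; have [-> ->] := clamp_itv y ab.
by rewrite /=; exact: le_lt_trans (clamp_Lipschitz _ _ ab) xyd.
Qed.

Lemma lebesgue_stieltjes_itvoc (F : cumulative R R) (c d : R) : c <= d ->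
  lebesgue_stieltjes_measure F `]c, d]%classic = (F d - F c)%:E.
Proof.
move=> cd; rewrite /lebesgue_stieltjes_measure /measure_extension.
rewrite measurable_mu_extE/=; last exact: is_ocitv.
by rewrite wlength_itv_bnd.
Qed.

(** The pair consists of the infimum and supremum of the trace of [I] on (a, b]. The half-open hull
    is what a Stieltjes measure evaluates; the open core carries the Lebesgue length. An empty trace
    is assigned (a, a), so that degenerate pairs lie to the left of all others. *)
Lemma open_itv_sandwich a b (I : set R) : a <= b -> open I -> is_interval I ->
  exists cd : R * R, [/\ a <= cd.1 /\ cd.1 <= cd.2, cd.2 <= b,
    I `&` `]a, b]%classic `<=` `]cd.1, cd.2]%classic,
    `]cd.1, cd.2[%classic `<=` I `&` `]a, b]%classic &
    cd.1 = cd.2 -> cd.1 = a].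
Proof.
move=> ab oI iI; set J := _ `&` _.
have [->|/set0P[j Jj]] := eqVneq J set0.
  exists (a, a); split=> //= x /=; rewrite in_itv/= => /andP[ax xa]; lra.
have Jab x : J x -> a < x /\ x <= b.
  by rewrite /J /= in_itv/= => -[_ /andP[]].
have hiJ : has_inf J.
  by split; [exists j|exists a => x /Jab[/ltW]].
have hsJ : has_sup J by split; [exists j|exists b => x /Jab[_]].
have infJ x : J x -> inf J < x.
  move=> Jx; rewrite lt_neqAle; apply/andP; split; last first.
    by apply: ge_inf => //; case: hiJ.
  apply/eqP => Ex; have [ax xb] := Jab x Jx; have [Ix _] := Jx.
  have [e /= e0 eI] := open_subball oI Ix.
  (* A point left of [x], within the ball contained in [I] and still above [a]: an attained infimum
     would not be a lower bound. *)
  pose y := Num.max (x - e / 4) ((x + a) / 2).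
  have yx : y < x by rewrite gt_max; apply/andP; split; lra.
  have ya : a < y by rewrite lt_max; apply/orP; right; lra.
  have yxe : x - e / 4 <= y by rewrite le_max lexx.
  suff Jy : J y.
    have : inf J <= y by apply: ge_inf => //; case: hiJ.
    by rewrite Ex; lra.
  split; last by rewrite /= in_itv/= ya/=; lra.
  apply: (eI (e / 2)) => //=; rewrite ?divr_gt0//.
    by rewrite sub0r normrN gtr0_norm ?divr_gt0//; lra.
  by rewrite /ball/= gtr0_norm ?subr_gt0//; lra.
have supJ x : J x -> x <= sup J by move=> Jx; apply: ub_le_sup => //; case: hsJ.
exists (inf J, sup J); split => /=.
- split; first by apply: lb_le_inf => [|x /Jab[/ltW]//]; exists j.
  by apply: ltW; apply: lt_le_trans (supJ _ Jj); exact: infJ.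
- by apply: ge_sup => [|x /Jab[_]//]; exists j.
- by move=> x Jx /=; rewrite in_itv/= infJ// supJ.
- move=> y /=; rewrite in_itv/= => /andP[iy ys].
  have [u Ju uy] : exists2 u, J u & u < y.
    have yi0 : 0 < y - inf J by rewrite subr_gt0.
    by have [u Ju] := inf_adherent yi0 hiJ; rewrite addrC subrK; exists u.
  have [v Jv yv] : exists2 v, J v & y < v.
    have yi0 : 0 < sup J - y by rewrite subr_gt0.
    by have [v Jv] := sup_adherent yi0 hsJ; rewrite opprB addrC subrK; exists v.
  split; first by apply: (iI u v); [case: Ju|case: Jv|rewrite !ltW].
  by have [? _] := Jab u Ju; have [_ ?] := Jab v Jv; rewrite /= in_itv/=; lra.
- by move=> E; have := infJ j Jj; have := supJ j Jj; rewrite -E; lra.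
Qed.

(* An open neighbourhood of N of small Lebesgue measure is a disjoint union of open
   intervals, on finitely many of which F varies little. *)
Lemma lebesgue_stieltjes_null (F : cumulative R R) a b (N : set R) :
  a <= b -> AC_on a b F -> measurable N -> mu N = 0%E ->
  lebesgue_stieltjes_measure F (N `&` `]a, b]%classic) = 0%E.
Proof.
move=> ab acF mN N0; set nu := lebesgue_stieltjes_measure F.
apply/eqP; rewrite eq_le measure_ge0 andbT; apply/lee_addgt0Pr => e e0.
rewrite add0e; have [d d0 D] := acF e e0.
have Noo : (mu N < +oo)%E by rewrite N0 ltry.
have [U [oU NU UNd]] := lebesgue_regularity_outer mN Noo d0.
have mU : measurable U by exact: open_measurable.
have Ud : (mu U < d%:E)%E.
  rewrite (le_lt_trans _ UNd)//.
  apply: (@le_trans _ _ (mu (U `\` N) + mu N)%E); last by rewrite N0 adde0.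
  rewrite (le_trans _ (measureU2 _ _ _))//; last exact: measurableD.
  by rewrite le_measure ?inE//; [apply: measurableU => //; exact: measurableD|
    move=> x Ux; have [Nx|Nx] := pselect (N x); [right|left]].
have [I [oiI tI UI]] := OpenSetDisjointItvs.open_disjoint_itv oU.
have [p Hp] := choice (fun k => open_itv_sandwich ab (oiI k).1 (oiI k).2).
pose J k := I k `&` `]a, b]%classic.
have mI k : measurable (I k) by apply: open_measurable; case: (oiI k).
have mJ k : measurable (J k) by apply: measurableI.
have mNab : measurable (N `&` `]a, b]%classic) by exact: measurableI.
have nuN : (nu (N `&` `]a, b]%classic) <= \sum_(k <oo) nu (J k))%E.
  apply: (measure_sigma_subadditive nu mJ mNab) => x [/NU + abx].
  by rewrite UI => -[k _ Ik]; exists k.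
rewrite (le_trans nuN)//; apply: lime_le.
  by apply: is_cvg_nneseries => k _ _; exact: measure_ge0.
apply: nearW => n; rewrite big_mkord.
apply: (@le_trans _ _ (\sum_(k < n) ((F (p k).2 - F (p k).1)%:E))%E).
  apply: lee_sum => k _; have [[h1 h2] h3 h4 _ _] := Hp k.
  rewrite -lebesgue_stieltjes_itvoc//; apply: le_measure => //; rewrite inE//.
  exact: mJ.
rewrite sumEFin lee_fin ltW//.
apply: (@le_lt_trans _ _ (\sum_(k < n) `|F (p k).2 - F (p k).1|)).
  by apply: ler_sum => k _; exact: ler_norm.
apply: (D n (fun k => p k)).
- by move=> k; have [[h1 h2] h3 _ _ _] := Hp k.
- move=> i j ij.
  have [[i1 i2] i3 _ i4 i5] := Hp i; have [[j1 j2] j3 _ j4 j5] := Hp j.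
  (* A degenerate segment sits at [a], hence precedes every other one. *)
  have [E|ine] := eqVneq (p i).1 (p i).2; first by left; rewrite -E i5.
  have [E|jne] := eqVneq (p j).1 (p j).2; first by right; rewrite -E j5.
  have [dicj|cjdi] := leP (p i).2 (p j).1; first by left.
  have [djci|cidj] := leP (p j).2 (p i).1; first by right.
  have cdi : (p i).1 < (p i).2 by rewrite lt_neqAle ine.
  have cdj : (p j).1 < (p j).2 by rewrite lt_neqAle jne.
  (* If two proper segments overlapped, the midpoint of their intersection would lie in both open
     cores, hence in two disjoint intervals of the family. *)
  pose l := Num.max (p i).1 (p j).1; pose r := Num.min (p i).2 (p j).2.
  have lr : l < r by rewrite gt_max !lt_min cdi cjdi cidj cdj.
  have [il jl] : (p i).1 <= l /\ (p j).1 <= l by rewrite !le_max !lexx orbT.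
  have [ri rj] : r <= (p i).2 /\ r <= (p j).2 by rewrite !ge_min !lexx orbT.
  have [Ii _] : J i ((l + r) / 2) by apply: i4; rewrite /= in_itv/=; lra.
  have [Ij _] : J j ((l + r) / 2) by apply: j4; rewrite /= in_itv/=; lra.
  have : (I i `&` I j) ((l + r) / 2) by split.
  by move/trivIsetP : tI => /(_ i j Logic.I Logic.I ij) ->.
(* The open cores lie in the disjoint intervals [I k], so the lengths sum to at most the measure of
   [U]. *)
- rewrite -lte_fin (le_lt_trans _ Ud)// -sumEFin.
  apply: (@le_trans _ _ (\sum_(k < n) mu (I k))%E).
    apply: lee_sum => k _; have [[h1 h2] h3 _ h4 _] := Hp k.
    apply: (@le_trans _ _ (mu `](p k).1, (p k).2[%classic)).
      by rewrite lebesgue_measure_itv/= lte_fin; case: ltP => // h; rewrite lee_fin; lra.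
    by apply: le_measure; rewrite ?inE//; [exact: mI|move=> x /h4[]].
  have /= <- := measure_bigsetU mu mI tI n.
  apply: le_measure; rewrite ?inE//.
    by apply: bigsetU_measurable => k _; exact: mI.
  by rewrite UI; exact: bigsetU_bigcup.
Qed.

Lemma AC_nondecreasing_density a b f : a <= b -> AC_on a b f ->
  {in `[a, b] &, nondecreasing_fun f} ->
  exists2 g : R -> R, mu.-integrable [set: R] (EFin \o g) &
  forall x, a <= x -> x <= b -> \int[mu]_(t in `[a, x]) g t = f x - f a.
Proof.
move=> ab acf ndf; pose F := f \o clamp a b.
have ndF : nondecreasing F.
  move=> x y xy; have [? ?] := clamp_itv x ab; have [? ?] := clamp_itv y ab.
  by apply: ndf; rewrite ?in_itv/= ?clamp_nondecreasing//; apply/andP.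
have cF : continuous F by apply: clamp_continuous => //; exact: AC_on_continuous.
pose cumF : cumulative R R := HB.pack F (isCumulative.Build R _ R F ndF (right_continuousW cF)).
have acF : AC_on a b cumF by apply: AC_on_eq acf => x ax xb; rewrite /= /F /= clamp_id.
have mab : measurable (`]a, b]%classic : set (measurableTypeR R)) by exact: measurable_itv.
have nuoo : (lebesgue_stieltjes_measure cumF `]a, b]%classic < +oo)%E.
  by rewrite lebesgue_stieltjes_itvoc// ltry.
(* Restricting to (a, b] makes the Stieltjes measure finite and confines it to the segment where
   absolute continuity is known. *)
pose nu : {finite_measure set (measurableTypeR R) -> \bar R} := mfrestr mab nuoo.
have numu : nu `<< mu.
  apply/null_content_dominatesP => N mN N0.
  exact: lebesgue_stieltjes_null.
have [g [g0 gfin gint gE]] := radon_nikodym_sigma_finite numu.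
have gEfin : EFin \o (fine \o g) = g by apply/funext => x /=; rewrite fineK.
exists (fine \o g); first by rewrite gEfin.
move=> x ax xb.
rewrite -Rintegral_itv_obnd_cbnd; last first.
  by rewrite gEfin; apply: integrableS gint.
rewrite /Rintegral; have := gE `]a, x]%classic (measurable_itv _).
rewrite -[in X in _ = X -> _]gEfin => <-.
rewrite /nu /= /mfrestr /mrestr setIidl.
  by rewrite lebesgue_stieltjes_itvoc//= /F /= !clamp_id.
by move=> y /=; rewrite !in_itv/= => /andP[-> yx]; exact: le_trans xb.
Qed.

Lemma AC_on_density a b f : a <= b -> AC_on a b f ->
  exists g : R -> R, [/\ mu.-integrable [set: R] (EFin \o g),
    forall x, a <= x -> x <= b -> \int[mu]_(t in `[a, x]) g t = f x - f a &
    {ae mu, forall x, a < x -> x < b -> is_derive x 1 f (g x)}].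
Proof.
move=> ab acf; have [u [v [acu acv ndu ndv fE]]] := AC_on_monotone_decomp ab acf.
have [gu igu guE] := AC_nondecreasing_density ab acu ndu.
have [gv igv gvE] := AC_nondecreasing_density ab acv ndv.
pose g : R -> R := gu \- gv.
have ig : mu.-integrable [set: R] (EFin \o g).
  by rewrite (_ : _ \o _ = (EFin \o gu) \- (EFin \o gv))%E//; exact: integrableB.
have igS (A : set R) : measurable A -> mu.-integrable A (EFin \o g).
  by move=> mA; apply: integrableS ig.
have gE x : a <= x -> x <= b -> \int[mu]_(t in `[a, x]) g t = f x - f a.
  move=> ax xb; rewrite RintegralB//; [|exact: integrableS igu|exact: integrableS igv].
  by rewrite guE// gvE// !fE; ring.
exists g; split => //.
have := FTC1 (fun y => igS _ (measurable_itv `[a, y])) (open_integrable_locally openT ig).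
apply: filterS; first exact: (ae_filter_ringOfSetsType mu).
move=> x /= H ax xb.
have [] := H _; first by rewrite lte_fin.
set F := (X in derivable X) => dF dFE.
have dF1 : is_derive x 1 F (g x) by rewrite -dFE derive1E; exact: derivableP.
have dF2 : is_derive x 1 (F + cst (f a)) (g x).
  by apply: (is_derive_eq (is_deriveD _ _)); rewrite addr0.
apply: near_eq_is_derive dF2 => //.
have xab : x \in `]a, b[ by rewrite in_itv/= ax.
near=> y; have : y \in `]a, b[ by near: y; exact: near_in_itvoo.
by rewrite in_itv/= /F => /andP[ay yb]; rewrite fctE gE ?subrK//; exact: ltW.
Unshelve. all: by end_near. Qed.

End AC_density.

(** * Derivatives relative to I *)

Section derivative_on_I.
Context {R : realType}.
Variables (T : R) (x0 : \bar R).
Implicit Types (f g : R -> R) (x y l : R).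
Local Notation mu := (@lebesgue_measure R).
Local Notation I := (Iset T x0).

(** Relational form of the derivative: it carries existence, whereas [dI] takes a default value
    where no limit exists. *)
Definition has_dI f x l := dq f x h @[h --> Ifilt T x0 x] --> l.

Lemma lte_room x : (x%:E < x0)%E -> exists2 d : R, 0 < d &
  forall y, y < x + d -> (y%:E < x0)%E.
Proof.
case: x0 => [r||//]; last by exists 1 => // y _; rewrite ltry.
rewrite lte_fin => xr; exists (r - x); first by rewrite subr_gt0.
by move=> y; rewrite addrC subrK lte_fin.
Qed.

Lemma Iset_le x y : I x -> x <= y -> (y%:E < x0)%E -> I y.
Proof. by move=> [Tx _] xy yx0; split => //; exact: le_trans xy. Qed.

Lemma Iset_ge x y : I y -> T <= x -> x <= y -> I x.
Proof. by move=> [_ yx0] Tx xy; split => //; apply: le_lt_trans yx0; rewrite lee_fin. Qed.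

Global Instance Ifilt_filter x : Filter (Ifilt T x0 x).
Proof. by rewrite /Ifilt; exact: within_filter. Qed.

(** Small positive increments stay in I, even at [T]; this makes the relative derivative unique. *)
Lemma Ifilt_proper x : I x -> ProperFilter (Ifilt T x0 x).
Proof.
move=> [Tx xx0]; have [d d0 D] := lte_room xx0.
apply: Build_ProperFilter_ex => A; rewrite /Ifilt /within /= => -[e /= e0 eA].
pose h := Num.min (e / 2) (d / 2).
have h0 : 0 < h by rewrite lt_min !divr_gt0.
have he : h <= e / 2 by rewrite ge_min lexx.
have hd : h <= d / 2 by rewrite ge_min lexx orbT.
exists h; apply: eA => /=; first by rewrite sub0r normrN gtr0_norm//; lra.
by rewrite gt_eqF//; split => //; split; [lra|apply: D; lra].
Qed.

Lemma near_Iset x : T < x -> (x%:E < x0)%E -> \forall h \near (0 : R), I (h + x).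
Proof.
move=> Tx xx0; have [d d0 D] := lte_room xx0.
exists (Num.min d (x - T)) => /=; first by rewrite lt_min d0 subr_gt0.
move=> h /=; rewrite sub0r normrN lt_min => /andP[hd hT].
have := ler_norm h; have := ler_norm (- h); rewrite normrN => h1 h2.
by split; [lra|apply: D; lra].
Qed.

(** At interior points small increments stay in I, so the derivative relative to I is the ordinary
    one. *)
Lemma Ifilt_dnbhs x : T < x -> (x%:E < x0)%E -> Ifilt T x0 x = 0^'.
Proof.
move=> Tx xx0; have nI := near_Iset Tx xx0.
apply/seteqP; split => A; rewrite /Ifilt /dnbhs /within /=.
  by apply: filterS2 nI => h Ih + h0; apply.
by apply: filterS => h Ah [h0 _]; exact: Ah.
Qed.

Lemma near_Ifilt_neq0 x : \forall h \near Ifilt T x0 x, h != 0.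
Proof. by rewrite /Ifilt near_withinE; near=> h => -[]. Unshelve. all: by end_near. Qed.

Lemma near_Ifilt_Iset x : \forall h \near Ifilt T x0 x, I (h + x).
Proof. by rewrite /Ifilt near_withinE; near=> h => -[]. Unshelve. all: by end_near. Qed.

Lemma Ifilt_id x : h @[h --> Ifilt T x0 x] --> (0 : R).
Proof. by rewrite /Ifilt; apply: cvg_within_filter; exact: cvg_id. Qed.

Lemma has_dI_unique f x l l' : I x -> has_dI f x l -> has_dI f x l' -> l = l'.
Proof. by move=> /Ifilt_proper FF; exact: cvg_unique. Qed.

Lemma has_dIE f x l : I x -> has_dI f x l -> dI T x0 f x = l.
Proof. by move=> /Ifilt_proper FF; exact: cvg_lim. Qed.

Lemma has_dI_ddiff f x l : has_dI f x l -> ddiff T x0 f x.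
Proof. by move=> h; apply/cvg_ex; exists l. Qed.

Lemma ddiff_has_dI f x : ddiff T x0 f x -> has_dI f x (dI T x0 f x).
Proof. by []. Qed.

Lemma has_dI_shift f x l : has_dI f x l -> f (h + x) @[h --> Ifilt T x0 x] --> f x.
Proof.
move=> df; have : f x + h * dq f x h @[h --> Ifilt T x0 x] --> f x + 0 * l.
  by apply: cvgD; [exact: cvg_cst|apply: cvgM df; exact: Ifilt_id].
rewrite mul0r addr0; apply: cvg_trans; apply: near_eq_cvg.
have := near_Ifilt_neq0 x; apply: filterS => h h0.
by rewrite /dq mulrA divff// mul1r addrC subrK.
Qed.

Lemma has_dI_eq f g x l : I x -> (forall t, I t -> f t = g t) ->
  has_dI f x l -> has_dI g x l.
Proof.
move=> Ix fg; apply: cvg_trans; apply: near_eq_cvg.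
have := near_Ifilt_Iset x; apply: filterS => h Ih.
by rewrite /dq !fg.
Qed.

Lemma has_dI_cst (c : R) x : has_dI (fun=> c) x 0.
Proof.
rewrite /has_dI (_ : dq _ x = cst 0); first exact: cvg_cst.
by apply/funext => h; rewrite /dq subrr mulr0.
Qed.

Lemma has_dID f g x l l' : has_dI f x l -> has_dI g x l' ->
  has_dI (fun t => f t + g t) x (l + l').
Proof.
move=> df dg; rewrite /has_dI.
rewrite (_ : dq _ x = fun h => dq f x h + dq g x h); first exact: cvgD.
by apply/funext => h; rewrite /dq -mulrDr; congr (_ * _); ring.
Qed.

Lemma has_dIM f g x l l' : has_dI f x l -> has_dI g x l' ->
  has_dI (fun t => f t * g t) x (l * g x + f x * l').
Proof.
move=> df dg; rewrite /has_dI.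
rewrite (_ : dq _ x = fun h => dq f x h * g (h + x) + f x * dq g x h).
  apply: cvgD; first by apply: cvgM df _; exact: has_dI_shift dg.
  by apply: cvgM => //; exact: cvg_cst.
by apply/funext => h; rewrite /dq; ring.
Qed.

Lemma has_dIZ (c : R) f x l : has_dI f x l -> has_dI (fun t => c * f t) x (c * l).
Proof.
move=> df; have := has_dIM (has_dI_cst c x) df.
by rewrite mul0r add0r.
Qed.

Lemma has_dIB f g x l l' : has_dI f x l -> has_dI g x l' ->
  has_dI (fun t => f t - g t) x (l - l').
Proof.
move=> df dg; have := @has_dIZ (-1) _ _ _ dg; rewrite mulN1r => {}dg.
rewrite (_ : (fun t => _) = (fun t => f t + -1 * g t)); first exact: has_dID.
by apply/funext => t; rewrite mulN1r.
Qed.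

Lemma has_dIV f x l : f x != 0 -> has_dI f x l ->
  has_dI (fun t => (f t)^-1) x (- l / f x ^+ 2).
Proof.
move=> fx0 df; have cf := has_dI_shift df.
have fn0 : \forall h \near Ifilt T x0 x, f (h + x) != 0 by exact: cvgr_neq0 cf fx0.
have : - dq f x h * ((f (h + x))^-1 * (f x)^-1) @[h --> Ifilt T x0 x] -->
    - l * ((f x)^-1 * (f x)^-1).
  apply: cvgM; first exact: cvgN.
  by apply: cvgM; [exact: cvgV|exact: cvg_cst].
rewrite -invfM -expr2; apply: cvg_trans; apply: near_eq_cvg.
apply: filterS fn0 => h fh0; rewrite /dq.
have -> : (f (h + x))^-1 - (f x)^-1 = - (f (h + x) - f x) * ((f (h + x))^-1 * (f x)^-1).
  by field; rewrite fx0 fh0.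
by rewrite !mulNr !mulrN !mulrA.
Qed.

Lemma has_dI_div f g x l l' : g x != 0 -> has_dI f x l -> has_dI g x l' ->
  has_dI (fun t => f t / g t) x ((g x * l - l' * f x) / g x ^+ 2).
Proof.
move=> gx0 df dg; have := has_dIM df (has_dIV gx0 dg).
by congr has_dI; field.
Qed.

Lemma has_dI_is_derive f x l : T < x -> (x%:E < x0)%E ->
  has_dI f x l <-> is_derive x 1 f l.
Proof.
move=> Tx xx0; rewrite /has_dI Ifilt_dnbhs//.
have dqE : (fun h : R => h^-1 *: ((f \o shift x) (h *: 1) - f x)) = dq f x.
  by apply/funext => h; rewrite /dq /= scaler1.
split => [df|[df fE]].
  apply: DeriveDef; first by rewrite /derivable dqE; apply/cvg_ex; exists l.
  by rewrite /derive dqE; apply/cvg_lim.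
by rewrite -fE /derive dqE; rewrite /derivable dqE in df.
Qed.

Lemma ddiff_continuous f : (forall x, I x -> ddiff T x0 f x) ->
  {within I, continuous f}.
Proof.
move=> df; apply/subspace_continuousP => x Ix.
have /cvgrPdist_lt H := has_dI_shift (df x Ix).
apply/cvgrPdist_lt => e e0; have [d /= d0 D] := H e e0.
rewrite near_withinE; exists d => //= y xyd Iy.
have [->|yx] := eqVneq y x; first by rewrite subrr normr0.
have := D (y - x); rewrite subrK; apply; last by rewrite subr_eq0 yx.
by rewrite /= sub0r normrN distrC.
Qed.

Lemma continuous_itv_within f x y : I x -> I y ->
  {within I, continuous f} -> {within `[x, y], continuous f}.
Proof.
move=> Ix [_ yx0]; apply: continuous_subspaceW => t; rewrite /= in_itv/= => /andP[xt ty].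
by apply: (Iset_le Ix xt); apply: le_lt_trans yx0; rewrite lee_fin.
Qed.

Lemma C1on_continuous f : C1on T x0 f -> {within I, continuous f}.
Proof. by move=> [df _]; exact: ddiff_continuous. Qed.

(** The derivative is bounded on compact segments, so the mean value theorem gives a Lipschitz
    constant there. *)
Lemma C1on_ACon f : C1on T x0 f -> ACon T x0 f.
Proof.
move=> C1f; have [df cdf] := C1f; move=> a b Ia Ib ab.
have /compact_bounded[N [Nr HN]] :=
  continuous_compact (continuous_itv_within Ia Ib cdf) (@segment_compact _ a b).
apply: (@AC_on_Lipschitz _ _ _ _ (`|N| + 1)) => x y ax xy yb.
move: xy; rewrite le_eqVlt => /predU1P[->|xy]; first by rewrite !subrr normr0 mulr0.
have [Ta _] := Ia; have [_ bx0] := Ib.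
have Ix : I x by apply: (Iset_ge Ib); lra.
have Iy : I y by apply: (Iset_ge Ib); lra.
have [|t|c cxy ->] := @MVT _ f (dI T x0 f) _ _ xy.
- move=> t; rewrite in_itv/= => /andP[xt ty].
  apply/has_dI_is_derive; [lra|by apply: le_lt_trans bx0; rewrite lee_fin; lra|].
  by apply/ddiff_has_dI/df; apply: (Iset_ge Ib); lra.
- by apply: continuous_itv_within; rewrite //; exact: C1on_continuous.
have yx0 : 0 <= y - x by rewrite subr_ge0 ltW.
rewrite normrM (ger0_norm yx0) ler_wpM2r//; apply: (HN (`|N| + 1)).
  by rewrite (le_lt_trans (ler_norm N))// ltrDl.
move: cxy; rewrite in_itv/= => /andP[xc cy].
by exists c => //=; rewrite in_itv/=; lra.
Qed.

Lemma ACon_continuous f x y : I x -> I y -> ACon T x0 f ->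
  {within `[x, y], continuous f}.
Proof.
move=> Ix Iy acf; have [xy|yx] := leP x y; first exact/AC_on_continuous/acf.
by rewrite set_itv_ge -?leNgt//; exact: continuous_subspace0.
Qed.

End derivative_on_I.

(** * Borel measurability of the derivative *)

Section measurable_derivative.
Context {R : realType}.
Implicit Types (f g : R -> R) (x y l : R).
Local Notation mu := (@lebesgue_measure R).

(* [integrable] refers to the Borel sigma-algebra, which is not complete, so being a.e.
   equal to a measurable function does not make a derivative measurable: the set of
   points of differentiability is written as a combination of closed sets. *)
Let quotient_gap f (d e : R) : set R := [set x | forall h k : R, h != 0 -> k != 0 ->
  `|h| < d -> `|k| < d -> `|dq f x h - dq f x k| <= e].

(** For fixed increments the condition is closed by continuity of [f]; the set is the intersection
    over all admissible pairs. *)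
Lemma closed_quotient_gap f d e : continuous f -> closed (quotient_gap f d e).
Proof.
move=> cf; pose A (p : R * R) := [set x | `|dq f x p.1 - dq f x p.2| <= e].
pose D := [set p : R * R | [/\ p.1 != 0, p.2 != 0, `|p.1| < d & `|p.2| < d]].
rewrite (_ : quotient_gap f d e = \bigcap_(p in D) A p); last first.
  apply/seteqP; split => x /= H; first by move=> p [? ? ? ?]; exact: H.
  by move=> h k *; apply: (H (h, k)).
apply: closed_bigI => p _.
have cdq h : continuous (fun x => dq f x h).
  move=> x; apply: cvgM; first exact: cvg_cst.
  apply: cvgB; last exact: cf.
  apply: (@cvg_comp _ _ _ (fun y => h + y) f _ (nbhs (h + x))); last exact: cf.
  by apply: cvgD; [exact: cvg_cst|exact: cvg_id].
apply: (@preimage_closed _ _ (fun x => `|dq f x p.1 - dq f x p.2|) [set y | y <= e]).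
  by move=> x _; apply: cvg_norm; apply: cvgB; exact: cdq.
exact: closed_le.
Qed.

(** Cauchy criterion for the difference quotients, with countably many tolerances and radii. *)
Lemma cvg_quotientP f x : cvg (dq f x h @[h --> 0^']) <->
  (\bigcap_n \bigcup_m quotient_gap f m.+1%:R^-1 n.+1%:R^-1) x.
Proof.
split=> [/cvg_ex[/= l /cvgrPdist_lt H] n _|H].
  have n0 : (0 : R) < n.+1%:R^-1 / 2 by rewrite divr_gt0// invr_gt0.
  have [d /= d0 D] := H _ n0.
  have [m md] : exists m : nat, m.+1%:R^-1 < d.
    exists (Num.bound d^-1); rewrite -[ltRHS]invrK ltf_pV2 ?posrE ?invr_gt0//.
    by rewrite (lt_trans (archi_boundP _)) ?invr_ge0 1?ltW// ltr_nat.
  exists m => //= h k h0 k0 hm km.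
  have Dh z : z != 0 -> `|z| < m.+1%:R^-1 -> `|l - dq f x z| < n.+1%:R^-1 / 2.
    by move=> z0 zm; apply: D => //=; rewrite sub0r normrN (lt_trans zm).
  have -> : dq f x h - dq f x k = (l - dq f x k) - (l - dq f x h) by ring.
  rewrite (le_trans (ler_normB _ _))//.
  by move: (Dh h h0 hm) (Dh k k0 km); move: (n.+1%:R^-1 : R) => w; lra.
apply/cauchy_cvgP; apply: cauchy_exP => e e0.
have [n ne] : exists n : nat, n.+1%:R^-1 < e.
  exists (Num.bound e^-1); rewrite -[ltRHS]invrK ltf_pV2 ?posrE ?invr_gt0//.
  by rewrite (lt_trans (archi_boundP _)) ?invr_ge0 1?ltW// ltr_nat.
have [m _ Hm] := H n Logic.I.
have m0 : (0 : R) < m.+1%:R^-1 by rewrite invr_gt0.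
pose k : R := m.+1%:R^-1 / 2; have k0 : 0 < k by rewrite divr_gt0.
exists (dq f x k).
suff : \forall h \near (0 : R)^', ball (dq f x k) e (dq f x h) by [].
rewrite /dnbhs near_withinE; exists m.+1%:R^-1 => //= h.
rewrite /= sub0r normrN => hm h0.
rewrite /ball/=; apply: le_lt_trans ne; apply: Hm => //.
  by rewrite gt_eqF.
by rewrite gtr0_norm// /k; move: (m.+1%:R^-1 : R) m0 => w; lra.
Qed.

(** On the set [D] of convergence the limit is that of the continuous quotients with increments
    1/(n+1); off [D], [lim] returns the constant [point]. *)
Lemma measurable_lim_quotient f : continuous f ->
  measurable_fun [set: R] (fun x => lim (dq f x h @[h --> 0^'])).
Proof.
move=> cf; pose D := [set x | cvg (dq f x h @[h --> 0^'])].
have mD : measurable D.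
  rewrite (_ : D = \bigcap_n \bigcup_m quotient_gap f m.+1%:R^-1 n.+1%:R^-1).
    apply: bigcapT_measurable => n; apply: bigcupT_measurable => m.
    apply: closed_measurable.
    exact: closed_quotient_gap.
  by apply/seteqP; split => x /cvg_quotientP.
rewrite -(setUv D); apply/measurable_funU => //; first exact: measurableC.
split.
  apply: (@measurable_fun_cvg _ _ R _ (fun n (x : R) => dq f x n.+1%:R^-1)).
    move=> n; apply: (@measurable_funS _ _ _ _ setT) => //.
    apply: measurable_funM => //.
    apply: measurable_funB; last exact: continuous_measurable_fun.
    apply: continuous_measurable_fun => x.
    apply: (@cvg_comp _ _ _ (fun y => n.+1%:R^-1 + y) f _ (nbhs (n.+1%:R^-1 + x))); last exact: cf.
    by apply: cvgD; [exact: cvg_cst|exact: cvg_id].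
  move=> x Dx; apply: (@cvg_comp _ _ _ _ (dq f x) _ (0^') _ _ Dx).
  move=> A; rewrite /dnbhs /within /= => nA.
  have H : \forall n \near \oo, (fun y => y != 0 -> A y) (@harmonic R n).
    by move: nA; exact: cvg_harmonic.
  by apply: filterS H => n /=; apply; rewrite invr_neq0.
apply: (@eq_measurable_fun _ _ _ _ _ (cst point)); last exact: measurable_cst.
by move=> x; rewrite inE => Dx; rewrite dvgP.
Qed.

(** The endpoints do not affect measurability; at interior points [f \o clamp a b], continuous on
    the whole line, has the same quotients as [f] for small increments. *)
Lemma measurable_dI T (x0 : \bar R) f a b : Iset T x0 a -> Iset T x0 b -> a <= b ->
  {within `[a, b], continuous f} -> measurable_fun `[a, b] (dI T x0 f).
Proof.
move=> Ia Ib ab cf; pose F := f \o clamp a b.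
apply/measurable_fun_itv_bndo_bndcP.
apply/measurable_fun_itv_obnd_cbndP.
apply: (@eq_measurable_fun _ _ _ _ _ (fun x => lim (dq F x h @[h --> 0^']))).
  move=> x; rewrite inE/= in_itv/= => /andP[ax xb].
  have [Ta _] := Ia; have [_ bx0] := Ib.
  rewrite /dI Ifilt_dnbhs; [|lra|by apply: le_lt_trans bx0; rewrite lee_fin ltW].
  have nE : {near (0 : R)^', dq F x =1 dq f x}.
    have : \forall h \near (0 : R), a < h + x < b.
      exists (Num.min (x - a) (b - x)); first by rewrite /= lt_min !subr_gt0 ax.
      move=> h /=; rewrite sub0r normrN lt_min => /andP[h1 h2].
      by have := ler_norm h; have := ler_norm (- h); rewrite normrN; lra.
    rewrite /dnbhs /prop_near1 /within /=; apply: filterS => h /andP[h1 h2] _.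
    by rewrite /dq /F /= !clamp_id ?ltW.
  have -> // : dq F x h @[h --> 0^'] = dq f x h @[h --> 0^'].
  apply/seteqP; split; apply: near_eq_cvg => //.
  by apply: filterS nE => h ->.
apply: (@measurable_funS _ _ _ _ setT) => //.
by apply: measurable_lim_quotient; exact: clamp_continuous.
Qed.


End measurable_derivative.

(** * Newton-Leibniz formula, comparison and Rolle's theorem up to x0 *)

Section improper_FTC.
Context {R : realType}.
Variables (T : R) (x0 : \bar R).
Implicit Types (f g G Q k s : R -> R) (x y l : R).
Local Notation mu := (@lebesgue_measure R).
Local Notation I := (Iset T x0).

Global Instance lebesgue_ae_filter : Filter (nbhs (almost_everywhere mu)).
Proof. exact: ae_filter_ringOfSetsType. Qed.

Lemma toward_proper x : (x%:E < x0)%E -> ProperFilter (toward x0).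
Proof.
case: x0 => [r||] _ /=; [exact: at_left_proper_filter|exact: proper_pinfty_nbhs|].
exact: proper_ninfty_nbhs.
Qed.

Lemma near_toward x : (x%:E < x0)%E ->
  \forall y \near toward x0, x < y /\ (y%:E < x0)%E.
Proof.
case: x0 => [r||//] /=; last first.
  by move=> _; near=> y; split; [near: y|exact: ltry];
  apply: nbhs_pinfty_gt; exact: num_real.
rewrite lte_fin => xr; near=> y; split; first by near: y; exact: nbhs_left_gt.
by rewrite lte_fin; near: y; exact: nbhs_left_lt.
Unshelve. all: by end_near. Qed.

Lemma ae_neq x : {ae mu, forall t, t != x}.
Proof.
exists [set x]; split => //; first exact: lebesgue_measure_set1.
by move=> t /=; move/negP; rewrite negbK => /eqP.
Qed.

Lemma ACon_ae_ddiff f x y : ACon T x0 f -> I x -> I y -> x <= y ->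
  {ae mu, forall t, x < t -> t < y -> ddiff T x0 f t}.
Proof.
move=> acf Ix Iy xy; have [g [_ _]] := AC_on_density xy (acf x y Ix Iy xy).
apply: filterS.
move=> t /= H xt ty; apply: has_dI_ddiff.
have [Tx _] := Ix; have [_ yx0] := Iy.
apply/has_dI_is_derive; [lra|by apply: le_lt_trans yx0; rewrite lee_fin ltW|].
exact: H.
Qed.

(** By uniqueness of derivatives [k] agrees almost everywhere with the density of [G], so
    integrability and the value of the integral transfer. *)
Lemma AC_on_integral_derivative G k x y : I x -> I y -> x <= y ->
  AC_on x y G -> measurable_fun `[x, y] k ->
  {ae mu, forall t, x < t -> t < y -> has_dI T x0 G t (k t)} ->
  mu.-integrable `[x, y] (EFin \o k) /\ \int[mu]_(t in `[x, y]) k t = G y - G x.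
Proof.
move=> Ix Iy xy acG mk Gk; have [g [ig gE dg]] := AC_on_density xy acG.
have igxy : mu.-integrable `[x, y] (EFin \o g) by exact: integrableS ig.
have mg := measurable_int _ igxy.
have mEk : measurable_fun (`[x, y]%classic : set (measurableTypeR R)) (EFin \o k)
  by exact/measurable_EFinP.
have kg : ae_eq mu `[x, y]%classic (EFin \o k) (EFin \o g).
  have FI := @filterI _ _ lebesgue_ae_filter.
  apply: filterS (FI _ _ (FI _ _ Gk dg) (FI _ _ (ae_neq x) (ae_neq y))) => t /=.
  move=> [[H1 H2] [tx ty]]; rewrite in_itv/= => /andP[xt yt].
  have {}xt : x < t by rewrite lt_neqAle eq_sym tx.
  have {}ty : t < y by rewrite lt_neqAle ty.
  have [Tx _] := Ix; have [_ yx0] := Iy; have It : I t by apply: (Iset_ge Iy); lra.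
  congr EFin; apply: (has_dI_unique It (H1 xt ty)).
  apply/has_dI_is_derive; [lra|by case: It|exact: H2].
split; last by rewrite -gE// /Rintegral (@ae_eq_integral _ _ _ mu _ _ _ _ _ _ kg).
apply/integrableP; split => //; have /integrableP[_] := igxy.
suff -> : (\int[mu]_(t in `[x, y]) `|(EFin \o k) t| =
           \int[mu]_(t in `[x, y]) `|(EFin \o g) t|)%E by [].
apply: (@ae_eq_integral _ _ _ mu _ (fun t => `|(EFin \o g) t|)%E
  (fun t => `|(EFin \o k) t|)%E).
- exact: measurable_itv.
- by apply: measurableT_comp.
- by apply: measurableT_comp.
- by apply: filterS kg => t /= H /H [->].
Qed.

(** The partial integrals are G(y) - G(x): convergence comes from the primitive alone, without
    absolute integrability up to x0. *)
Lemma iint_AC G k x l : I x ->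
  (forall y, x <= y -> (y%:E < x0)%E -> AC_on x y G) ->
  (forall y, x <= y -> (y%:E < x0)%E -> measurable_fun `[x, y] k) ->
  (forall y, x <= y -> (y%:E < x0)%E ->
    {ae mu, forall t, x < t -> t < y -> has_dI T x0 G t (k t)}) ->
  G @ toward x0 --> l -> iint_ex x0 k x /\ iint x0 k x = l - G x.
Proof.
move=> Ix acG mk dG Gl; have [Tx xx0] := Ix.
have FF := toward_proper xx0.
have H y : x <= y -> (y%:E < x0)%E -> mu.-integrable `[x, y] (EFin \o k) /\
    \int[mu]_(t in `[x, y]) k t = G y - G x.
  by move=> xy yx0; apply: AC_on_integral_derivative; auto; exact: Iset_le Ix _ _.
have pk : partial_int k x @ toward x0 --> l - G x.
  have : G y - G x @[y --> toward x0] --> l - G x by apply: cvgB => //; exact: cvg_cst.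
  apply: cvg_trans; apply: near_eq_cvg; apply: filterS (near_toward xx0) => y [xy yx0].
  by rewrite /partial_int -set_itvcc; have [_ ->] := H y (ltW xy) yx0.
split; last exact: cvg_lim.
split; last by apply/cvg_ex; exists (l - G x).
by move=> y xy yx0; rewrite -set_itvcc; have [] := H y xy yx0.
Qed.

Lemma iint_eq g k x : (x%:E < x0)%E -> (forall t, x <= t -> (t%:E < x0)%E -> g t = k t) ->
  iint_ex x0 g x -> iint_ex x0 k x /\ iint x0 k x = iint x0 g x.
Proof.
move=> xx0 gk [ig cg].
have FF := toward_proper xx0.
have E y : x <= y -> (y%:E < x0)%E -> {in [set t | x <= t <= y], g =1 k}.
  move=> xy yx0 t; rewrite inE/= => /andP[xt ty]; apply: gk => //.
  by apply: le_lt_trans yx0; rewrite lee_fin.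
have pE : {near toward x0, partial_int g x =1 partial_int k x}.
  apply: filterS (near_toward xx0) => y [/ltW xy yx0].
  by apply: eq_Rintegral => t /(E y xy yx0).
have ck : partial_int k x @ toward x0 --> iint x0 g x.
  apply: cvg_trans cg; apply: near_eq_cvg; exact: pE.
split; last exact: cvg_lim.
split; last by apply/cvg_ex; exists (iint x0 g x).
move=> y xy yx0; apply: eq_integrable (ig y xy yx0).
  by rewrite -set_itvcc; exact: measurable_itv.
by move=> t /(E y xy yx0) /= ->.
Qed.

(** The density equals its absolute value almost everywhere, so its integral, the increment of [G],
    is nonnegative. *)
Lemma AC_on_le G x y : I x -> I y -> x <= y -> AC_on x y G ->
  {ae mu, forall t, x < t -> t < y -> exists2 l : R, 0 <= l & has_dI T x0 G t l} ->
  G x <= G y.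
Proof.
move=> Ix Iy xy acG dG; have [g [ig gE dg]] := AC_on_density xy acG.
rewrite -subr_ge0 -gE//.
have igxy : mu.-integrable `[x, y] (EFin \o g) by exact: integrableS ig.
have mg := measurable_int _ igxy.
have kg : ae_eq mu `[x, y]%classic (EFin \o g) (EFin \o (fun t => `|g t|)).
  have FI := @filterI _ _ lebesgue_ae_filter.
  apply: filterS (FI _ _ (FI _ _ dG dg) (FI _ _ (ae_neq x) (ae_neq y))) => t /=.
  move=> [[H1 H2] [tx ty]]; rewrite in_itv/= => /andP[xt yt].
  have {}xt : x < t by rewrite lt_neqAle eq_sym tx.
  have {}ty : t < y by rewrite lt_neqAle ty.
  have [Tx _] := Ix; have [_ yx0] := Iy; have It : I t by apply: (Iset_ge Iy); lra.
  have [l l0 Hl] := H1 xt ty.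
  rewrite ger0_norm// (_ : g t = l)//; apply: (has_dI_unique It _ Hl).
  apply/has_dI_is_derive; [lra|by case: It|exact: H2].
rewrite /Rintegral (@ae_eq_integral _ _ _ mu _ _ _ _ _ _ kg)//.
  by apply: fine_ge0; apply: integral_ge0 => t _; rewrite lee_fin.
by apply: (@measurableT_comp _ _ _ _ _ _ abse _ (EFin \o g)).
Qed.

(* As Q' has constant sign, |G'| <= M |Q'| makes M Q - G and M Q + G monotone. *)
Lemma comparison_bound G Q q s x (M : R) : I x -> 0 <= M ->
  (forall y, x <= y -> (y%:E < x0)%E -> AC_on x y G) ->
  (forall y, x <= y -> (y%:E < x0)%E -> AC_on x y Q) ->
  (forall y, x <= y -> (y%:E < x0)%E -> {ae mu, forall t, x < t -> t < y ->
     [/\ has_dI T x0 Q t (q t), has_dI T x0 G t (q t * s t) & `|s t| <= M]}) ->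
  (forall t, x < t -> (t%:E < x0)%E -> 0 <= q t) ->
  G @ toward x0 --> 0 -> Q @ toward x0 --> 0 ->
  `|G x| <= M * `|Q x|.
Proof.
move=> Ix M0 acG acQ dGQ q0 G0 Q0; have [Tx xx0] := Ix.
have FF := toward_proper xx0.
(* A nondecreasing function with limit 0 is nonpositive; the signs 1 and -1 together bound |G x| by
   - M Q(x). *)
suff H (e : R) : `|e| = 1 -> M * Q x + e * G x <= 0.
  have := H 1 (normr1 _); have := H (-1); rewrite normrN normr1 => /(_ erefl) h1 h2.
  have Mq : M * Q x <= 0 by lra.
  rewrite -[X in _ <= X * _]ger0_norm// -normrM (ler0_norm Mq) ler_norml; lra.
move=> e1; pose H t := M * Q t + e * G t.
have H0 : H @ toward x0 --> M * 0 + e * 0.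
  by apply: cvgD; apply: cvgM => //; exact: cvg_cst.
rewrite !mulr0 addr0 in H0.
rewrite -/(H x) -(cvg_lim (@Rhausdorff R) H0); apply: limr_ge.
  by apply/cvg_ex; exists 0.
have := near_toward xx0; apply: filterS => y [/ltW xy yx0].
have Iy : I y by exact: Iset_le Ix xy yx0.
apply: AC_on_le => //.
  by apply: AC_onD; apply: AC_onZ; auto.
apply: filterS (dGQ y xy yx0) => t Ht xt ty.
have [hQ hG sM] := Ht xt ty.
exists (M * q t + e * (q t * s t)); last by apply: has_dID; exact: has_dIZ.
have q0t : 0 <= q t by apply: q0 => //; apply: lt_trans yx0; rewrite lte_fin.
have : `|e * s t| <= M by rewrite normrM e1 mul1r.
rewrite ler_norml => /andP[h1 h2].
have -> : M * q t + e * (q t * s t) = q t * (M + e * s t) by ring.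
by apply: mulr_ge0 => //; lra.
Qed.

(** If H(y) is nonzero for some y > x, the value H(y)/2 is attained before y, since H(x) = 0, and
    again after y, since H tends to 0. The classical Rolle theorem applies between these two
    points. *)
Lemma Rolle_toward (H dH : R -> R) x : (x%:E < x0)%E ->
  (forall y, x < y -> (y%:E < x0)%E -> {within `[x, y], continuous H}) ->
  (forall t, x < t -> (t%:E < x0)%E -> is_derive t 1 H (dH t)) ->
  H x = 0 -> H @ toward x0 --> 0 ->
  exists t, [/\ x < t, (t%:E < x0)%E & dH t = 0].
Proof.
move=> xx0 cH hH Hx H0; have FF := toward_proper xx0.
have rolle a b : x <= a -> a < b -> (b%:E < x0)%E -> H a = H b ->
    exists t, [/\ x < t, (t%:E < x0)%E & dH t = 0].
  move=> xa ab bx0 Hab.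
  have tx0 t : t < b -> (t%:E < x0)%E.
    by move=> tb; apply: lt_trans bx0; rewrite lte_fin.
  have dab t : t \in `]a, b[ -> derivable H t 1.
    rewrite in_itv/= => /andP[at_ tb].
    by have [] := hH t (le_lt_trans xa at_) (tx0 t tb).
  have cab : {within `[a, b], continuous H}.
    apply: continuous_subspaceW (cH b (le_lt_trans xa ab) bx0) => t /=.
    by rewrite !in_itv/= => /andP[? ->]; rewrite andbT (le_trans xa).
  have [t] := Rolle ab dab cab Hab; rewrite in_itv/= => /andP[at_ tb] Ht.
  have xt := le_lt_trans xa at_; exists t; split => //; first exact: tx0.
  by have [_ <-] := hH t xt (tx0 t tb); case: Ht.
have /filter_ex[y [xy yx0]] := near_toward xx0.
have [Hy|Hy] := eqVneq (H y) 0; first by apply: (rolle x y) => //; rewrite Hy.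
have v0 : 0 < `|H y| / 2 by rewrite divr_gt0// normr_gt0.
move/cvgrPdist_lt : H0 => /(_ _ v0) nH.
have /filter_ex[z [Hz [yz zx0]]] : \forall z \near toward x0,
    `|0 - H z| < `|H y| / 2 /\ y < z /\ (z%:E < x0)%E.
  by apply: filterI nH _; exact: near_toward.
rewrite sub0r normrN in Hz.
have xz := lt_trans xy yz.
have Hv : Num.min (H x) (H y) <= H y / 2 <= Num.max (H x) (H y).
  rewrite Hx ge_min le_max; have [h|h] := leP 0 (H y); lra.
have Hv' : Num.min (H y) (H z) <= H y / 2 <= Num.max (H y) (H z).
  rewrite ge_min le_max; have := ler_norm (H z); have := ler_norm (- H z); rewrite normrN.
  by move: Hz; have [h|h] := leP 0 (H y); [rewrite (ger0_norm h)|rewrite (ltr0_norm h)]; lra.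
have [c1] := IVT (ltW xy) (cH y xy yx0) Hv; rewrite in_itv/= => /andP[xc cy] Hc1.
have cyz : {within `[y, z], continuous H}.
  apply: continuous_subspaceW (cH z xz zx0) => t /=.
  by rewrite !in_itv/= => /andP[? ->]; rewrite andbT; lra.
have [c2] := IVT (ltW yz) cyz Hv'; rewrite in_itv/= => /andP[yc cz] Hc2.
have c1y : c1 != y by apply/eqP => E; move: Hc1 Hy; rewrite E => ?; apply/negP/negPn/eqP; lra.
apply: (rolle c1 c2) => //; last by rewrite Hc1.
  by rewrite (lt_le_trans _ yc)// lt_neqAle c1y.
by apply: le_lt_trans zx0; rewrite lee_fin.
Qed.

End improper_FTC.

(** * Behaviour near the right endpoint *)

Section near_endpoint.
Context {R : realType}.
Variables (T : R) (x0 : \bar R).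
Implicit Types (f g G : R -> R) (x y l : R).
Local Notation mu := (@lebesgue_measure R).
Local Notation I := (Iset T x0).

Lemma toward_itv x (U : set R) : (x%:E < x0)%E -> (\forall y \near toward x0, U y) ->
  exists y, [/\ x < y, (y%:E < x0)%E & forall z, y < z -> (z%:E < x0)%E -> U z].
Proof.
case: x0 => [r|_|//] /=.
  rewrite lte_fin => xr; rewrite near_withinE => -[e /= e0 H].
  exists (Num.max (r - e / 2) ((x + r) / 2)); split.
  - by rewrite lt_max; apply/orP; right; lra.
  - by rewrite lte_fin gt_max; apply/andP; split; lra.
  move=> z; rewrite gt_max => /andP[z1 z2]; rewrite lte_fin => zr.
  by apply: H => //=; rewrite gtr0_norm; lra.
move=> [M [Mr HM]]; exists (Num.max M (x + 1)); split.
- by rewrite lt_max; apply/orP; right; lra.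
- exact: ltry.
- by move=> z; rewrite gt_max => /andP[Mz _] _; exact: HM.
Qed.

Lemma ae_itv_ex (a b : R) (Pr : R -> Prop) : a < b ->
  {ae mu, forall t, a < t -> t < b -> Pr t} -> exists t, [/\ a < t, t < b & Pr t].
Proof.
move=> ab [N [mN N0 HN]]; apply/not_existsP => H.
suff : (mu `]a, b[%classic <= mu N)%E.
  by rewrite N0 lebesgue_measure_itv/= lte_fin ab -EFinB lee_fin; lra.
apply: le_measure; rewrite ?inE//.
move=> t /=; rewrite in_itv/= => /andP[at_ tb]; apply: HN => /= Ht.
by apply: (H t); split => //; exact: Ht.
Qed.

Lemma within_toward_proper (D : set R) x : I x ->
  (forall a b, I a -> I b -> a < b -> exists t, [/\ a < t, t < b & D t]) ->
  ProperFilter (within D (toward x0)).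
Proof.
move=> Ix Dd; apply: Build_ProperFilter_ex => A; rewrite /within /= => nA.
have [_ xx0] := Ix; have [y [xy yx0 HA]] := toward_itv xx0 nA.
have FF := toward_proper xx0.
have /filter_ex[z [yz zx0]] := near_toward yx0.
have Iy : I y := Iset_le Ix (ltW xy) yx0.
have [t [yt tz Dt]] := Dd y z Iy (Iset_le Iy (ltW yz) zx0) yz.
by exists t; apply: HA => //; apply: lt_trans zx0; rewrite lte_fin.
Qed.

(** Each point z near x0 has a point of [D] just to its right where [G] is almost the same; being to
    the right, it is still in the neighbourhood controlled by the limit along [D]. *)
Lemma cvg_within_dense G l (D : set R) x : I x ->
  (forall a b, I a -> I b -> a < b -> exists t, [/\ a < t, t < b & D t]) ->
  {within I, continuous G} ->
  G @ within D (toward x0) --> l -> G @ toward x0 --> l.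
Proof.
move=> Ix Dd /subspace_continuousP cG /cvgrPdist_lt H.
apply/cvgrPdist_lt => e e0; have [_ xx0] := Ix.
have e20 : 0 < e / 2 by rewrite divr_gt0.
have nG := H _ e20; rewrite near_withinE in nG.
have [y [xy yx0 HG]] := toward_itv xx0 nG.
have Iy : I y := Iset_le Ix (ltW xy) yx0.
have := near_toward yx0; apply: filterS => z [yz zx0].
have Iz : I z := Iset_le Iy (ltW yz) zx0.
have /cvgrPdist_lt/(_ _ e20) := cG z Iz; rewrite near_withinE => -[d /= d0 Hd].
have [d' d'0 Hd'] := lte_room zx0.
pose c := z + Num.min d d' / 2.
have md : Num.min d d' <= d by rewrite ge_min lexx.
have md' : Num.min d d' <= d' by rewrite ge_min lexx orbT.
have m0 : 0 < Num.min d d' by rewrite lt_min d0.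
have Ic : I c by apply: (Iset_le Iz); [|apply: Hd']; rewrite /c; lra.
have [|t [zt tc Dt]] := Dd z c Iz Ic; first by rewrite /c; lra.
have It : I t by apply: (Iset_ge Ic); [case: Iz; lra|exact: ltW].
have h1 : `|l - G t| < e / 2 by apply: HG => //; [exact: lt_trans yz zt|case: It].
have h2 : `|G z - G t| < e / 2.
  by apply: Hd => //=; rewrite ltr0_norm; rewrite /c in tc; lra.
have -> : l - G z = (l - G t) - (G z - G t) by ring.
by rewrite (le_lt_trans (ler_normB _ _))//; lra.
Qed.

Lemma ACon_dense f (a b : R) : ACon T x0 f -> I a -> I b -> a < b ->
  exists t, [/\ a < t, t < b & Df T x0 f t].
Proof.
move=> acf Ia Ib ab; have H := ACon_ae_ddiff acf Ia Ib (ltW ab).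
have [t [at_ tb dt]] := ae_itv_ex ab H; exists t; split => //; split => //.
by apply: (Iset_ge Ib); [case: Ia; lra|exact: ltW].
Qed.

Lemma ACon_continuousI f : ACon T x0 f -> {within I, continuous f}.
Proof.
move=> acf; apply/subspace_continuousP => x Ix.
have [Tx xx0] := Ix; have [d' d'0 Hd'] := lte_room xx0.
have Ic : I (x + d' / 2) by apply: (Iset_le Ix); [|apply: Hd']; lra.
have IT : I T by split => //; apply: le_lt_trans xx0; rewrite lee_fin.
have Tc : T <= x + d' / 2 by lra.
apply/cvgrPdist_lt => e e0; have [d d0 D] := AC_on_unif (acf _ _ IT Ic Tc) e0.
rewrite near_withinE; exists (Num.min d (d' / 2)); first by rewrite /= lt_min d0 divr_gt0.
move=> y /=; rewrite lt_min => /andP[xyd xyd'] [Ty _].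
by have := ler_norm (y - x); rewrite distrC => yx; apply: D => //; lra.
Qed.

Lemma dI_eq f g x : I x -> (forall t, I t -> f t = g t) -> dI T x0 f x = dI T x0 g x.
Proof.
move=> Ix fg; rewrite /dI.
have nE : {near Ifilt T x0 x, dq f x =1 dq g x}.
  by apply: filterS (near_Ifilt_Iset T x0 x) => h Ih; rewrite /dq !fg.
have -> // : dq f x h @[h --> Ifilt T x0 x] = dq g x h @[h --> Ifilt T x0 x].
apply/seteqP; split; apply: near_eq_cvg => //.
by apply: filterS nE => h ->.
Qed.

(** Serves to exhaust [x, x0) by countably many compact segments, for finite and infinite x0
    alike. *)
Lemma cofinal_seq : exists y : nat -> R, (forall n, (-oo < x0)%E -> ((y n)%:E < x0)%E) /\
  forall t : R, (t%:E < x0)%E -> exists n, t <= y n.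
Proof.
case: x0 => [r||]; last by exists (fun=> 0); split.
  exists (fun n => r - n.+1%:R^-1); split => [n _|t].
    by rewrite lte_fin gtrBl invr_gt0.
  rewrite lte_fin -subr_gt0 => tr.
  exists (Num.bound (r - t)^-1); rewrite lerBrDr -lerBrDl.
  rewrite -[leRHS]invrK lef_pV2 ?posrE ?invr_gt0//.
  have rt0 : 0 <= (r - t)^-1 by rewrite invr_ge0 ltW.
  by rewrite (le_trans (ltW (archi_boundP rt0)))// ler_nat.
exists (fun n => n%:R); split => [n _|t _]; first exact: ltry.
exists (Num.bound `|t|); rewrite (le_trans (ler_norm t))//.
by rewrite ltW// archi_boundP.
Qed.

Lemma norm_iint_le h x t : I x -> x <= t -> (t%:E < x0)%E ->
  (forall y, x <= y -> (y%:E < x0)%E -> measurable_fun `[x, y] h) ->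
  iint_ex x0 h t ->
  (`|iint x0 h t|%:E <= \int[mu]_(s in [set s : R | (x <= s)%R /\ (s%:E < x0)%E]) `|h s|%:E)%E.
Proof.
move=> Ix xt tx0 mh [ih ch]; set D := [set s | _].
have FF := toward_proper tx0.
have [y [yx0 yt]] := cofinal_seq.
have [Tx xx0] := Ix; have x0Ny : (-oo < x0)%E by apply: lt_trans xx0; rewrite ltNyr.
have DE : D = \bigcup_n `[x, y n]%classic.
  apply/seteqP; split => s /=.
    by move=> [xs /yt[n syn]]; exists n => //=; rewrite in_itv/= xs.
  move=> [n _] /=; rewrite in_itv/= => /andP[xs syn]; split => //.
  by apply: le_lt_trans (yx0 n x0Ny); rewrite lee_fin.
have mD : measurable D by rewrite DE; apply: bigcupT_measurable => n; exact: measurable_itv.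
have mhD : measurable_fun D h.
  rewrite DE; apply/measurable_fun_bigcup => n; first exact: measurable_itv.
  have [xyn|ynx] := leP x (y n); first by apply: mh => //; exact: yx0.
  by rewrite set_itv_ge -?leNgt ?bnd_simp -?ltNge//; exact: measurable_fun_set0.
have mahD : measurable_fun (D : set (measurableTypeR R)) (fun s => `|h s|%:E).
  by apply/measurable_EFinP; exact: measurableT_comp.
(* If the integral of the absolute value is infinite the bound is trivial; otherwise it bounds every
   partial integral. *)
have [->|Mfin] := eqVneq (\int[mu]_(s in D) `|h s|%:E)%E +oo%E; first exact: leey.
have M0 : (0 <= \int[mu]_(s in D) `|h s|%:E)%E.
  by apply: integral_ge0 => s _; rewrite lee_fin.
rewrite -(@fineK _ (\int[mu]_(s in D) `|h s|%:E)%E) ?ge0_fin_numE ?ltey//.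
set M := fine _; rewrite lee_fin.
have nM : (\int[mu]_(s in D) `|h s|%:E)%E = M%:E.
  by rewrite /M fineK// ge0_fin_numE// ltey.
have cn : `|partial_int h t z| @[z --> toward x0] --> `|iint x0 h t|.
  exact: cvg_norm.
rewrite -(cvg_lim (@Rhausdorff R) cn); apply: limr_le; first by apply/cvg_ex; exists `|iint x0 h t|.
have := near_toward tx0; apply: filterS => z [/ltW tz zx0].
have itz := ih z tz zx0.
have mtz : measurable [set s : R | t <= s <= z] by rewrite -set_itvcc; exact: measurable_itv.
rewrite /partial_int (le_trans (le_normr_Rintegral _ itz))//.
rewrite -lee_fin -nM /Rintegral fineK; last first.
  by have /integrable_norm/integrable_fin_num := itz; apply.
apply: ge0_subset_integral => // s /= /andP[ts sz].
by split; [exact: le_trans ts|apply: le_lt_trans zx0; rewrite lee_fin].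
Qed.

(** Reduces extended-real estimates to a finite [S]: for infinite [S] the right side is infinite, as
    C > 0. *)
Lemma lee_mul_bound (A C : R) (S : \bar R) : 0 < C -> (0 <= S)%E ->
  (forall M, S = M%:E -> A <= M * C) -> (A%:E <= C%:E * S)%E.
Proof.
case: S => [M||//] C0 _ H; first by rewrite -EFinM lee_fin mulrC; exact: H.
by rewrite gt0_muley ?lte_fin// leey.
Qed.

Lemma ess_sup_bound (g : R -> R) (A C x : R) : (x%:E < x0)%E -> 0 < C ->
  (forall M, 0 <= M -> {ae mu, forall t, x < t -> (t%:E < x0)%E -> `|g t| <= M} ->
    A <= M * C) ->
  (A%:E <= C%:E * ess_sup mu
     (fun t => if (x < t)%R && (t%:E < x0)%E then (`|g t|)%:E else 0%E))%E.
Proof.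
move=> xx0 C0 H; set h := fun t => _; have hS := ess_sup_ge mu h.
(* The almost-everywhere bound holds at some actual point, where [h] is nonnegative. *)
have S0 : (0 <= ess_sup mu h)%E.
  have H' : {ae mu, forall t, x < t -> t < x + 1 -> (h t <= ess_sup mu h)%E}.
    by apply: filterS hS => t Ht _ _.
  have [|t [_ _]] := ae_itv_ex _ H'; first by rewrite ltrDl.
  by apply: le_trans; rewrite /h; case: ifP.
apply: lee_mul_bound => // M SM; apply: H; first by rewrite -lee_fin -SM.
apply: filterS hS => t; rewrite SM /h => Ht xt tx0.
by move: Ht; rewrite xt tx0 lee_fin.
Qed.

End near_endpoint.

(** * Limit tangent curves *)

Section limit_tangent.
Context {R : realType}.
Variables (T : R) (x0 : \bar R) (p1 p2 f : R -> R) (a1 a2 : R).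
Implicit Types (x y t l u v : R).
Local Notation mu := (@lebesgue_measure R).
Local Notation I := (Iset T x0).
Local Notation W := (Wr T x0 p1 p2).
Local Notation d := (dI T x0).
Local Notation f1 := (f1s T x0 p1 p2 f).
Local Notation f2 := (f2s T x0 p1 p2 f).
Local Notation Lf := (Lop T x0 p1 p2 f).

Hypothesis Tx0 : (T%:E < x0)%E.
Hypothesis C1p1 : C1on T x0 p1.
Hypothesis C1p2 : C1on T x0 p2.
Hypothesis p21o : p2 =o_ (towardF x0) p1.
Hypothesis p1n0 : forall x, I x -> p1 x != 0.
Hypothesis p2n0 : forall x, I x -> p2 x != 0.
Hypothesis Wn0 : forall x, I x -> W x != 0.
Hypothesis acf : ACon T x0 f.
Hypothesis f1a1 : f1 @ within (Df T x0 f) (toward x0) --> a1.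
Hypothesis f2a2 : f2 @ within (Df T x0 f) (toward x0) --> a2.

(* phi1, phi2 and Phi are [lin_comb u v] for (u, v) = (1, 0), (0, 1) and
   (phi2 T, - phi1 T); [wr_gap u v] is then W(lin_comb u v, remainder) / W, that is
   f2* - a2, -(f1* - a1) and F* - gamma. *)
Definition lin_comb u v t := u * p1 t + v * p2 t.
Definition wr_gap u v t := u * (f2 t - a2) - v * (f1 t - a1).
Definition remainder t := f t - a1 * p1 t - a2 * p2 t.

Lemma Iset_left : I T. Proof. by []. Qed.

Lemma has_dI_phi1 t : I t -> has_dI T x0 p1 t (d p1 t).
Proof. by case: C1p1 => + _ => /[apply]. Qed.
Lemma has_dI_phi2 t : I t -> has_dI T x0 p2 t (d p2 t).
Proof. by case: C1p2 => + _ => /[apply]. Qed.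

Lemma Wr12E t : W t = p1 t * d p2 t - d p1 t * p2 t. Proof. by []. Qed.
Lemma f1sE t : f1 t = (f t * d p2 t - d f t * p2 t) / W t. Proof. by []. Qed.
Lemma f2sE t : f2 t = - (f t * d p1 t - d f t * p1 t) / W t. Proof. by []. Qed.

(** Cramer's rule: f1* and f2* solve the linear system for (f, f') whose determinant is W. This
    identity and the next are algebraic in the value [d f t]. *)
Lemma decomp_f t : I t -> f t = f1 t * p1 t + f2 t * p2 t.
Proof.
move=> It; have := Wn0 It; rewrite f1sE f2sE Wr12E => W0; field; exact: W0.
Qed.

Lemma decomp_df t : I t -> d f t = f1 t * d p1 t + f2 t * d p2 t.
Proof.
move=> It; have := Wn0 It; rewrite f1sE f2sE Wr12E => W0; field; exact: W0.
Qed.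

Lemma has_dI_comb u v t : I t -> has_dI T x0 (lin_comb u v) t (u * d p1 t + v * d p2 t).
Proof. by move=> It; apply: has_dID; apply: has_dIZ; [exact: has_dI_phi1|exact: has_dI_phi2]. Qed.

Lemma has_dI_comb_ratio u v u' v' t : I t -> lin_comb u v t != 0 ->
  has_dI T x0 (fun s => lin_comb u' v' s / lin_comb u v s) t
    ((u * v' - v * u') * (W t / lin_comb u v t ^+ 2)).
Proof.
move=> It c0; have := has_dI_div c0 (@has_dI_comb u' v' t It) (@has_dI_comb u v t It).
congr has_dI; rewrite Wr12E mulrA; congr (_ / _); rewrite /lin_comb; ring.
Qed.

Lemma has_dI_rem t : Df T x0 f t -> has_dI T x0 remainder t (d f t - a1 * d p1 t - a2 * d p2 t).
Proof.
move=> [It dft]; apply: has_dIB; last exact/has_dIZ/has_dI_phi2.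
by apply: has_dIB; [exact: ddiff_has_dI|exact/has_dIZ/has_dI_phi1].
Qed.

Lemma has_dI_rem_ratio u v t : Df T x0 f t -> lin_comb u v t != 0 ->
  has_dI T x0 (fun s => remainder s / lin_comb u v s) t (W t / lin_comb u v t ^+ 2 * wr_gap u v t).
Proof.
move=> Dt c0; have [It _] := Dt.
have := has_dI_div c0 (has_dI_rem Dt) (@has_dI_comb u v t It).
congr has_dI; rewrite mulrAC; congr (_ / _).
rewrite /remainder (decomp_df It) {1}(decomp_f It) Wr12E /wr_gap /lin_comb; ring.
Qed.

Lemma ACon_p1 : ACon T x0 p1. Proof. exact: C1on_ACon. Qed.
Lemma ACon_p2 : ACon T x0 p2. Proof. exact: C1on_ACon. Qed.

Lemma AC_comb u v x y : I x -> I y -> x <= y -> AC_on x y (lin_comb u v).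
Proof. by move=> Ix Iy xy; apply: AC_onD; apply: AC_onZ; [exact: ACon_p1|exact: ACon_p2]. Qed.

Lemma AC_rem x y : I x -> I y -> x <= y -> AC_on x y remainder.
Proof.
move=> Ix Iy xy; have acp1 := AC_onZ a1 (ACon_p1 Ix Iy xy).
exact: AC_onB (AC_onB (acf Ix Iy xy) acp1) (AC_onZ a2 (ACon_p2 Ix Iy xy)).
Qed.

Lemma AC_div (g h : R -> R) x y : (forall t, x <= t -> t <= y -> h t != 0) ->
  AC_on x y g -> AC_on x y h -> AC_on x y (fun t => g t / h t).
Proof. by move=> h0 acg ach; apply: AC_onM => //; exact: AC_onV. Qed.

Lemma continuous_W : {within I, continuous W}.
Proof.
move=> t; have c1 := C1on_continuous C1p1; have c2 := C1on_continuous C1p2.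
have [_ c1'] := C1p1; have [_ c2'] := C1p2.
by apply: cvgB; apply: cvgM; [exact: c1|exact: c2'|exact: c1'|exact: c2].
Qed.

(** W is continuous and has no zero, so the intermediate value theorem excludes a change of sign. *)
Lemma W_same_sign t : I t -> 0 < W T * W t.
Proof.
move=> It; rewrite ltNge; apply/negP => WW; have [Tt _] := It.
have W1 := Wn0 Iset_left; have W2 := Wn0 It.
have cW := continuous_itv_within Iset_left It continuous_W.
have /(IVT Tt cW)[c] : Num.min (W T) (W t) <= 0 <= Num.max (W T) (W t).
  rewrite ge_min le_max; have [h|h] := ltP 0 (W T).
    by rewrite (ltW h) -(pmulr_rle0 _ h) WW orbT.
  have {}h : W T < 0 by rewrite lt_neqAle W1.
  by rewrite /= -(nmulr_rle0 (W t) h) WW orbT.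
rewrite in_itv/= => /andP[Tc ct] /eqP; apply/negP/Wn0; exact: Iset_ge It Tc ct.
Qed.

Lemma W_sign : exists2 e : R, e * e = 1 & forall t, I t -> 0 < e * W t.
Proof.
have [WT|WT] := ltP 0 (W T).
  exists 1 => [|t /W_same_sign]; first by rewrite mulr1.
  by rewrite mul1r pmulr_rgt0.
have {}WT : W T < 0 by rewrite lt_neqAle Wn0//; exact: Iset_left.
exists (-1) => [|t /W_same_sign]; first by rewrite mulrNN mulr1.
by rewrite mulN1r oppr_gt0 nmulr_rgt0.
Qed.

Lemma ratio21_0 : p2 t / p1 t @[t --> toward x0] --> 0.
Proof.
apply/cvgrPdist_le => e e0; have /eqoP/(_ e e0) := p21o.
move=> H; have := near_toward Tx0; apply: filterS2 H => t H [Tt tx0].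
have It : I t by split => //; exact: ltW.
by rewrite sub0r normrN normrM normfV ler_pdivrMr ?normr_gt0 ?p1n0.
Qed.

Lemma Df_dense a b : I a -> I b -> a < b -> exists t, [/\ a < t, t < b & Df T x0 f t].
Proof. exact: ACon_dense. Qed.

(** Makes limits along the points of differentiability unique, so that gamma, defined by [lim], can
    be computed. *)
Lemma within_Df_proper : ProperFilter (within (Df T x0 f) (toward x0)).
Proof. exact: within_toward_proper Iset_left Df_dense. Qed.

Lemma cvg_Fs : Fs T x0 p1 p2 f t @[t --> within (Df T x0 f) (toward x0)] -->
  p1 T * a1 + p2 T * a2.
Proof. by apply: cvgD; apply: cvgM => //; exact: cvg_cst. Qed.

Lemma lim_Fs : lim (Fs T x0 p1 p2 f @ within (Df T x0 f) (toward x0)) =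
  p1 T * a1 + p2 T * a2.
Proof. by have FF := within_Df_proper; apply: cvg_lim => //; exact: cvg_Fs. Qed.

(** Where f is differentiable the quotient is (f1* - a1) + (f2* - a2) phi2/phi1, and phi2/phi1 tends
    to 0. *)
Lemma rem1_0 : remainder t / p1 t @[t --> toward x0] --> 0.
Proof.
apply: (cvg_within_dense Iset_left Df_dense).
  apply/subspace_continuousP => t It.
  have /subspace_continuousP cf := ACon_continuousI acf.
  have /subspace_continuousP c1 := C1on_continuous C1p1.
  have /subspace_continuousP c2 := C1on_continuous C1p2.
  apply: cvgM; last by apply: cvgV; [exact: p1n0|exact: c1].
  apply: cvgB; last by apply: cvgM; [exact: cvg_cst|exact: c2].
  by apply: cvgB; [exact: cf|apply: cvgM; [exact: cvg_cst|exact: c1]].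
have : (f1 t - a1) + (f2 t - a2) * (p2 t / p1 t) @[t --> within (Df T x0 f) (toward x0)]
    --> (a1 - a1) + (a2 - a2) * 0.
  apply: cvgD; first by apply: cvgB => //; exact: cvg_cst.
  apply: cvgM; first by apply: cvgB => //; exact: cvg_cst.
  by apply: cvg_within_filter; exact: ratio21_0.
rewrite !subrr mul0r addr0; apply: cvg_trans; apply: near_eq_cvg.
rewrite near_withinE; apply: nearW => t [It _].
by rewrite /remainder {1}(decomp_f It); field; exact: p1n0.
Qed.

Lemma measurable_dens u v x y : I x -> I y -> x <= y -> measurable_fun `[x, y] (wr_gap u v).
Proof.
move=> Ix Iy xy.
have mc (g : R -> R) : {within I, continuous g} -> measurable_fun `[x, y] g.
  move=> cg; apply: subspace_continuous_measurable_fun => //.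
  exact: (continuous_itv_within Ix Iy).
have [_ c1'] := C1p1; have [_ c2'] := C1p2.
have mp1 := mc _ (C1on_continuous C1p1); have mp2 := mc _ (C1on_continuous C1p2).
have mp1' := mc _ c1'; have mp2' := mc _ c2'.
have mW := mc _ continuous_W.
have mf : measurable_fun `[x, y] f.
  apply: subspace_continuous_measurable_fun => //.
  exact: (ACon_continuous Ix Iy acf).
have mf' : measurable_fun `[x, y] (d f).
  by apply: measurable_dI => //; exact: (ACon_continuous Ix Iy acf).
have mWV : measurable_fun `[x, y] (fun t => (W t)^-1).
  apply: mc; apply/subspace_continuousP => t It; apply: cvgV; first exact: Wn0.
  by have /subspace_continuousP := continuous_W; exact.
have mf2 : measurable_fun `[x, y] f2.
  apply: measurable_funM => //; apply: measurableT_comp => //.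
  by apply: measurable_funB; exact: measurable_funM.
have mf1 : measurable_fun `[x, y] f1.
  by apply: measurable_funM => //; apply: measurable_funB; exact: measurable_funM.
by apply: measurable_funB; apply: measurable_funM => //; apply: measurable_funB.
Qed.

Lemma AC_comb_ratio (c : R) (g : R -> R) u v x y : I x -> I y -> x <= y ->
  (forall t, x <= t -> (t%:E < x0)%E -> lin_comb u v t != 0) -> AC_on x y g ->
  AC_on x y (fun t => c * (g t / lin_comb u v t)).
Proof.
move=> Ix Iy xy c0 acg; apply/AC_onZ/AC_div => //; last exact: AC_comb.
by move=> t xt ty; apply: c0 => //; case: (Iy) => _; apply: le_lt_trans; rewrite lee_fin.
Qed.

(** The scalar [c] absorbs the signs that occur in the iterated formulas. *)
Lemma ratio_formula (c : R) u v x : I x ->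
  (forall t, x <= t -> (t%:E < x0)%E -> lin_comb u v t != 0) ->
  remainder t / lin_comb u v t @[t --> toward x0] --> 0 ->
  iint_ex x0 (fun t => c * (W t / lin_comb u v t ^+ 2 * wr_gap u v t)) x /\
  iint x0 (fun t => c * (W t / lin_comb u v t ^+ 2 * wr_gap u v t)) x =
  - (c * (remainder x / lin_comb u v x)).
Proof.
move=> Ix c0 rc0; rewrite -sub0r.
apply: (iint_AC (G := fun t => c * (remainder t / lin_comb u v t)) Ix)
  => [y xy yx0|y xy yx0|y xy yx0|].
- have Iy := Iset_le Ix xy yx0; apply: AC_comb_ratio => //; exact: AC_rem.
- have Iy := Iset_le Ix xy yx0.
  apply: measurable_funM => //; apply: measurable_funM; last exact: measurable_dens.
  apply: subspace_continuous_measurable_fun => //.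
  have cW := continuous_itv_within Ix Iy continuous_W.
  have cc := AC_on_continuous (AC_comb u v Ix Iy xy).
  apply/subspace_continuousP => t txy; apply: cvgM.
    by move/subspace_continuousP : cW; apply.
  apply: cvgV; last by apply: cvgM; move/subspace_continuousP : cc; apply.
  move: txy; rewrite /= in_itv/= => /andP[xt ty]; rewrite expf_neq0//; apply: c0 => //.
  by apply: le_lt_trans yx0; rewrite lee_fin.
- have Iy := Iset_le Ix xy yx0.
  apply: filterS (ACon_ae_ddiff acf Ix Iy xy) => t H xt ty.
  have tx0 : (t%:E < x0)%E by apply: lt_trans yx0; rewrite lte_fin.
  apply/has_dIZ/has_dI_rem_ratio; last exact: c0 (ltW xt) tx0.
  by split; [exact: Iset_le Ix (ltW xt) tx0|exact: H].
- rewrite -[X in _ --> X](mulr0 c); apply: cvgM => //; exact: cvg_cst.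
Qed.

(** With determinant 1 the derivative of q/p is exactly W/p^2, so remainder/p has that derivative
    times [wr_gap]; the common denominator p(x) then cancels from the comparison. *)
Lemma ratio_bound u v u' v' x (M : R) : I x -> u * v' - v * u' = 1 -> 0 <= M ->
  (forall t, x <= t -> (t%:E < x0)%E -> lin_comb u v t != 0) ->
  (forall y, x <= y -> (y%:E < x0)%E ->
     {ae mu, forall t, x < t -> t < y -> ddiff T x0 f t -> `|wr_gap u v t| <= M}) ->
  remainder t / lin_comb u v t @[t --> toward x0] --> 0 ->
  lin_comb u' v' t / lin_comb u v t @[t --> toward x0] --> 0 ->
  `|remainder x| <= M * `|lin_comb u' v' x|.
Proof.
move=> Ix det M0 c0 dM rc0 qc0; have [e ee eW] := W_sign.
have ne : `|e| = 1.
  by apply/eqP; rewrite -(@eqrXn2 _ 2)// ?normr_ge0// expr1n -normrX expr2 ee normr1.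
have Ix0 t : x <= t -> (t%:E < x0)%E -> I t by exact: Iset_le.
(* The sign [e] makes the derivative of q/p nonnegative and is put on [wr_gap] too, where e * e = 1
   restores the derivative of remainder/p. The factor 1 matches the shape in [AC_comb_ratio]. *)
have := @comparison_bound _ T x0 (fun t => 1 * (remainder t / lin_comb u v t))
  (fun t => e * (lin_comb u' v' t / lin_comb u v t)) (fun t => e * (W t / lin_comb u v t ^+ 2))
  (fun t => e * wr_gap u v t) x M Ix M0.
have xx0 := proj2 Ix; have cx := c0 x (lexx _) xx0.
rewrite mul1r !normrM ne mul1r normfV mulrA ler_pM2r ?invr_gt0 ?normr_gt0//; apply.
- by move=> y xy yx0; apply: AC_comb_ratio; auto; apply: AC_rem; auto.
- by move=> y xy yx0; apply: AC_comb_ratio; auto; apply: AC_comb; auto.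
- move=> y xy yx0; have Iy := Ix0 y xy yx0.
  have FI := @filterI _ _ (@lebesgue_ae_filter R).
  apply: filterS (FI _ _ (ACon_ae_ddiff acf Ix Iy xy) (dM y xy yx0)) => t /= [H HM] xt ty.
  have tx0 : (t%:E < x0)%E by apply: lt_trans yx0; rewrite lte_fin.
  have It := Ix0 t (ltW xt) tx0; have ct := c0 t (ltW xt) tx0.
  split.
  + by apply: has_dIZ; have := @has_dI_comb_ratio u v u' v' t It ct; rewrite det mul1r.
  + have := has_dIZ (c := 1) (has_dI_rem_ratio (conj It (H xt ty)) ct).
    by congr has_dI; rewrite mul1r mulrACA ee mul1r.
  + by rewrite normrM ne mul1r; apply: HM => //; exact: H.
- move=> t xt tx0; rewrite mulrA divr_ge0 ?sqr_ge0// ltW// eW//.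
  exact: Ix0 (ltW xt) tx0.
- by under eq_fun do rewrite mul1r.
- by rewrite -(mulr0 e); apply: cvgM => //; exact: cvg_cst.
Qed.

Lemma ratio_mean u v u' v' x : C1on T x0 f -> I x -> u * v' - v * u' = 1 ->
  (forall t, x <= t -> (t%:E < x0)%E -> lin_comb u v t != 0) ->
  lin_comb u' v' x != 0 ->
  remainder t / lin_comb u v t @[t --> toward x0] --> 0 ->
  lin_comb u' v' t / lin_comb u v t @[t --> toward x0] --> 0 ->
  exists t, [/\ x < t, (t%:E < x0)%E & remainder x = lin_comb u' v' x * wr_gap u v t].
Proof.
move=> [df _] Ix det c0 qx0 rc0 qc0; have [Tx xx0] := Ix.
have Ix0 t : x <= t -> (t%:E < x0)%E -> I t by exact: Iset_le.
(* Chosen so that [H] vanishes at [x]; as [H] also tends to 0 at x0, a zero of its derivative is a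
   point where [wr_gap] equals [c]. *)
pose c := remainder x / lin_comb u' v' x.
pose H t := 1 * (remainder t / lin_comb u v t) - c * (lin_comb u' v' t / lin_comb u v t).
pose dH t := W t / lin_comb u v t ^+ 2 * (wr_gap u v t - c).
have [||||t [xt tx0 Ht]] := @Rolle_toward _ x0 H dH x xx0.
- move=> y /ltW xy yx0; have Iy := Ix0 y xy yx0; apply: AC_on_continuous.
  apply: AC_onB; apply: AC_comb_ratio => //; [exact: AC_rem|exact: AC_comb].
- move=> t xt tx0; have It := Ix0 t (ltW xt) tx0; have ct := c0 t (ltW xt) tx0.
  apply/(@has_dI_is_derive _ T x0) => //; first exact: le_lt_trans xt.
  have h1 := has_dIZ (c := 1) (has_dI_rem_ratio (conj It (df t It)) ct).
  have h2 := has_dIZ (c := c) (@has_dI_comb_ratio u v u' v' t It ct).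
  have := has_dIB h1 h2; congr has_dI; rewrite det /dH; ring.
- by rewrite /H /c mul1r mulrA divfK// subrr.
- have : 1 * (remainder t / lin_comb u v t) - c * (lin_comb u' v' t / lin_comb u v t)
    @[t --> toward x0]
    --> 1 * 0 - c * 0.
    by apply: cvgB; apply: cvgM => //; exact: cvg_cst.
  by rewrite !mulr0 subrr.
have It := Ix0 t (ltW xt) tx0; have ct := c0 t (ltW xt) tx0.
exists t; split => //; move/eqP : Ht; rewrite /dH !mulf_eq0 invr_eq0 expf_eq0/=.
rewrite (negPf (Wn0 It)) (negPf ct)/= subr_eq0 => /eqP ->.
by rewrite /c mulrC divfK.
Qed.

Lemma lin_comb10 : lin_comb 1 0 = p1. Proof. by apply/funext => t; rewrite /lin_comb; ring. Qed.
Lemma lin_comb01 : lin_comb 0 1 = p2. Proof. by apply/funext => t; rewrite /lin_comb; ring. Qed.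
Lemma lin_combP : lin_comb (p2 T) (- p1 T) = Phi T p1 p2.
Proof. by apply/funext => t; rewrite /lin_comb /Phi; ring. Qed.
Lemma lin_comb0V : lin_comb 0 (p2 T)^-1 = fun t => p2 t / p2 T.
Proof. by apply/funext => t; rewrite /lin_comb; ring. Qed.
Lemma wr_gap10 t : wr_gap 1 0 t = f2 t - a2. Proof. by rewrite /wr_gap; ring. Qed.
Lemma wr_gapP t : wr_gap (p2 T) (- p1 T) t =
  Fs T x0 p1 p2 f t - (p1 T * a1 + p2 T * a2).
Proof. by rewrite /wr_gap /Fs; ring. Qed.

Lemma rem_bound1 x (M : R) : I x -> 0 <= M ->
  (forall y, x <= y -> (y%:E < x0)%E ->
     {ae mu, forall t, x < t -> t < y -> ddiff T x0 f t -> `|f2 t - a2| <= M}) ->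
  `|remainder x| <= M * `|p2 x|.
Proof.
move=> Ix M0 H; rewrite -lin_comb01; apply: (@ratio_bound 1 0) => //.
- by rewrite mulr1 mul0r subr0.
- by move=> t xt tx0; rewrite lin_comb10; apply: p1n0; exact: Iset_le xt tx0.
- move=> y xy yx0; apply: filterS (H y xy yx0) => t Ht xt ty dt.
  by rewrite wr_gap10; exact: Ht.
- by rewrite lin_comb10; exact: rem1_0.
- by rewrite lin_comb10 lin_comb01; exact: ratio21_0.
Qed.

(** Here (f1* - a1) phi1/phi2 would be an indeterminate product. Instead [rem_bound1] is applied at
    each z near x0, with M = e bounding f2* - a2 beyond z. *)
Lemma rem2_0 : remainder t / p2 t @[t --> toward x0] --> 0.
Proof.
apply/cvgrPdist_le => e e0; have /cvgrPdist_le/(_ e e0) := f2a2.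
rewrite near_withinE => nf; have [y [Ty yx0 Hy]] := toward_itv Tx0 nf.
have := near_toward yx0; apply: filterS => z [yz zx0].
have Iz : I z by split => //; exact: ltW (lt_trans Ty yz).
rewrite sub0r normrN normrM normfV ler_pdivrMr ?normr_gt0 ?p2n0//.
apply: rem_bound1 => //; first exact: ltW.
move=> y' zy' y'x0; apply: nearW => t zt ty' dt; rewrite distrC.
have tx0 : (t%:E < x0)%E by apply: lt_trans y'x0; rewrite lte_fin.
apply: Hy => //; first exact: lt_trans zt.
by split => //; exact: Iset_le Iz (ltW zt) tx0.
Qed.

(** A zero of Phi at x means that phi2/phi1 takes the same value at T and x; Rolle's theorem would
    then give a zero of W/phi1^2. *)
Lemma Phi_neq0 x : T < x -> (x%:E < x0)%E -> Phi T p1 p2 x != 0.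
Proof.
move=> Tx xx0; apply/eqP => P0; have Ix : I x by split => //; exact: ltW.
pose g t := lin_comb 0 1 t / lin_comb 1 0 t.
have dg t : T < t -> t < x -> is_derive t 1 g (W t / p1 t ^+ 2).
  move=> Tt tx; have It : I t by apply: Iset_ge Ix _ _; exact: ltW.
  apply/(@has_dI_is_derive _ T x0) => //; first by case: It.
  have c0 : lin_comb 1 0 t != 0 by rewrite lin_comb10 p1n0.
  by have := @has_dI_comb_ratio 1 0 0 1 t It c0; rewrite /g lin_comb10 mulr1 mul0r subr0 mul1r.
have [|||c cTx dc] := @Rolle _ g T x Tx.
- by move=> t; rewrite in_itv/= => /andP[Tt tx]; have [] := dg t Tt tx.
- rewrite (_ : g = fun t => 1 * (lin_comb 0 1 t / lin_comb 1 0 t)); last first.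
    by apply/funext => t; rewrite mul1r.
  apply: AC_on_continuous; apply: AC_comb_ratio => //; [exact: ltW| |].
    by move=> t Tt tx0; rewrite lin_comb10 p1n0//.
  by apply: AC_comb => //; exact: ltW.
- rewrite /g lin_comb10 lin_comb01; have pT := p1n0 Iset_left; have px := p1n0 Ix.
  apply/eqP; rewrite eqr_div//; apply/eqP.
  by move: P0; rewrite /Phi => /eqP; rewrite subr_eq0 => /eqP ->; rewrite mulrC.
move: cTx; rewrite in_itv/= => /andP[Tc cx].
have Ic : I c by apply: Iset_ge Ix _ _; exact: ltW.
have := dg c Tc cx => -[_ dE]; move: dE; case: dc => _ -> /esym/eqP.
by rewrite mulf_eq0 invr_eq0 expf_eq0/= (negPf (Wn0 Ic)) (negPf (p1n0 Ic)).
Qed.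

(** Phi/phi1 = phi2(T) - phi1(T) phi2/phi1 has the nonzero limit phi2(T). Limits of quotients by
    phi1 thus pass to quotients by Phi. *)
Lemma PhiV1 : p1 t / Phi T p1 p2 t @[t --> toward x0] --> (p2 T)^-1.
Proof.
have : (p2 T - p1 T * (p2 t / p1 t))^-1 @[t --> toward x0] --> (p2 T - p1 T * 0)^-1.
  apply: cvgV; first by rewrite mulr0 subr0 p2n0//; exact: Iset_left.
  apply: cvgB; first exact: cvg_cst.
  by apply: cvgM; [exact: cvg_cst|exact: ratio21_0].
rewrite mulr0 subr0; apply: cvg_trans; apply: near_eq_cvg.
have := near_toward Tx0; apply: filterS => t [Tt tx0].
have It : I t by split => //; exact: ltW.
have := Phi_neq0 Tt tx0; rewrite /Phi => P0; have p0 := p1n0 It.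
rewrite -[in LHS](divfK p0 (p2 T)) mulrAC mulrA -mulrBl invfM invrK mulrC.
by [].
Qed.

Lemma remP_0 : remainder t / Phi T p1 p2 t @[t --> toward x0] --> 0.
Proof.
have : (remainder t / p1 t) * (p1 t / Phi T p1 p2 t) @[t --> toward x0] --> 0 * (p2 T)^-1.
  by apply: cvgM; [exact: rem1_0|exact: PhiV1].
rewrite mul0r; apply: cvg_trans; apply: near_eq_cvg.
have := near_toward Tx0; apply: filterS => t [Tt tx0] /=.
by rewrite mulrA divfK// p1n0//; split => //; exact: ltW.
Qed.

Lemma ratioP_0 : p2 t / p2 T / Phi T p1 p2 t @[t --> toward x0] --> 0.
Proof.
have : (p2 t / p1 t) * (p1 t / Phi T p1 p2 t) * (p2 T)^-1 @[t --> toward x0]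
    --> 0 * (p2 T)^-1 * (p2 T)^-1.
  apply: cvgM; last exact: cvg_cst.
  by apply: cvgM; [exact: ratio21_0|exact: PhiV1].
rewrite !mul0r; apply: cvg_trans; apply: near_eq_cvg.
have := near_toward Tx0; apply: filterS => t [Tt tx0] /=.
by rewrite mulrA divfK ?p1n0//; [rewrite mulrAC|split => //; exact: ltW].
Qed.

Lemma rem_boundP_interior x (M : R) : T < x -> (x%:E < x0)%E -> 0 <= M ->
  (forall y, x <= y -> (y%:E < x0)%E ->
     {ae mu, forall t, x < t -> t < y -> ddiff T x0 f t ->
       `|Fs T x0 p1 p2 f t - (p1 T * a1 + p2 T * a2)| <= M}) ->
  `|remainder x| <= M * `|p2 x / p2 T|.
Proof.
move=> Tx xx0 M0 H; have Ix : I x by split => //; exact: ltW.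
rewrite -[p2 x / p2 T]/((fun t => p2 t / p2 T) x) -lin_comb0V.
apply: (@ratio_bound (p2 T) (- p1 T)) => //.
- by rewrite mulr0 subr0 divff// p2n0//; exact: Iset_left.
- by move=> t xt tx0; rewrite lin_combP Phi_neq0// (lt_le_trans Tx).
- move=> y xy yx0; apply: filterS (H y xy yx0) => t Ht xt ty dt.
  by rewrite wr_gapP; exact: Ht.
- by rewrite lin_combP; exact: remP_0.
- by rewrite lin_combP lin_comb0V; exact: ratioP_0.
Qed.

Lemma rem_boundP x (M : R) : I x -> 0 <= M ->
  {ae mu, forall t, x < t -> (t%:E < x0)%E -> ddiff T x0 f t ->
       `|Fs T x0 p1 p2 f t - (p1 T * a1 + p2 T * a2)| <= M} ->
  `|remainder x| <= M * `|p2 x / p2 T|.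
Proof.
move=> Ix M0 H.
have int z : x <= z -> T < z -> (z%:E < x0)%E -> `|remainder z| <= M * `|p2 z / p2 T|.
  move=> xz Tz zx0; apply: rem_boundP_interior => // y zy yx0.
  apply: filterS H => t Ht zt ty dt; apply: Ht => //; first exact: le_lt_trans zt.
  by apply: lt_trans yx0; rewrite lte_fin.
have [Tx xx0] := Ix; have [xT|] := ltP T x; first exact: int.
move=> xT; have {xT Tx}Ex : x = T by apply/eqP; rewrite eq_le xT.
subst x; rewrite leNgt; apply/negP => lt_T.
have [c [Tc cx0 _]] := toward_itv Tx0 (near_toward Tx0).
have Ic : I c by split => //; exact: ltW.
have acB : AC_on T c (fun t => M * (1 * (lin_comb 0 (p2 T)^-1 t))).
  by apply/AC_onZ/AC_onZ/AC_comb => //; exact: ltW.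
have acr := AC_rem Iset_left Ic (ltW Tc).
(* Half of the supposed excess at T: each side of the estimate moves by less than this between T and
   a nearby z, contradicting the estimate at z. *)
have e0 : 0 < (`|remainder T| - M * `|p2 T / p2 T|) / 2 by rewrite divr_gt0// subr_gt0.
have [d1 d10 D1] := AC_on_unif acB e0; have [d2 d20 D2] := AC_on_unif acr e0.
pose m := Num.min (Num.min d1 d2) (c - T).
have m0 : 0 < m by rewrite !lt_min d10 d20 subr_gt0.
have [md1 [md2 mc]] : m <= d1 /\ m <= d2 /\ m <= c - T.
  by rewrite /m !ge_min !lexx !orbT.
pose z := T + m / 2.
have Tz : T < z by rewrite /z; lra.
have zc : z <= c by rewrite /z; lra.
have zx0 : (z%:E < x0)%E by apply: le_lt_trans cx0; rewrite lee_fin.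
have zT : `|z - T| = m / 2 by rewrite /z addrAC subrr add0r ger0_norm//; lra.
have := D1 T z (lexx _) (ltW Tc) (ltW Tz) zc; have := D2 T z (lexx _) (ltW Tc) (ltW Tz) zc.
rewrite zT => /(_ ltac:(lra)) h2 /(_ ltac:(lra)) h1.
have := int z (ltW Tz) Tz zx0; rewrite lin_comb0V !mul1r in h1.
have := ler_dist_dist (M * (p2 z / p2 T)) (M * (p2 T / p2 T)).
have := ler_dist_dist (remainder z) (remainder T).
rewrite !(normrM M) (ger0_norm M0) => k1 k2 k3.
have /ltr_normlP[l1 _] := le_lt_trans k1 h2.
have /ltr_normlP[_ l2] := le_lt_trans k2 h1.
lra.
Qed.

(** * AC^1 data and the operator L *)

Hypothesis AC1p1 : ACon T x0 (d p1).
Hypothesis AC1p2 : ACon T x0 (d p2).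
Hypothesis C1f : C1on T x0 f.
Hypothesis AC1f : ACon T x0 (d f).

Lemma ACon_Wr (g h : R -> R) : ACon T x0 g -> ACon T x0 h -> ACon T x0 (d g) ->
  ACon T x0 (d h) -> ACon T x0 (Wr T x0 g h).
Proof.
move=> ag ah adg adh x y Ix Iy xy.
exact: AC_onB (AC_onM (ag x y Ix Iy xy) (adh x y Ix Iy xy))
  (AC_onM (adg x y Ix Iy xy) (ah x y Ix Iy xy)).
Qed.

Lemma ACon_f2s : ACon T x0 f2.
Proof.
move=> x y Ix Iy xy; apply: AC_div.
- by move=> t xt ty; apply/Wn0/(Iset_ge Iy) => //; case: Ix => Tx _; lra.
- apply: (AC_on_eq (f := fun t => -1 * Wr T x0 f p1 t)) => [t _ _|].
    by rewrite mulN1r.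
  by apply: AC_onZ; apply: ACon_Wr => //; exact: ACon_p1.
- by apply: ACon_Wr => //; [exact: ACon_p1|exact: ACon_p2].
Qed.

(** For f in C^1 every point of I is a point of differentiability, so the restricted limits are full
    limits. *)
Lemma cvg_toward_Df (g : R -> R) l : g @ within (Df T x0 f) (toward x0) --> l ->
  g @ toward x0 --> l.
Proof.
apply: cvg_trans => A; rewrite /fmap /= /within /= => nA.
have H := near_toward Tx0; apply: (@filterS2 _ _ (toward_filter x0) _ _ _ _ H nA).
move=> t [Tt tx0] HA; apply: HA.
have It : I t by split => //; exact: ltW.
by split => //; case: C1f => + _; apply.
Qed.

(** The bracket phi1^2/W (f/phi1)' in the factorised form of L is f2* itself. *)
Lemma LopE t : I t -> Lf t = W t / p1 t * d f2 t.
Proof.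
move=> It; rewrite /Lop; congr (_ * _); apply: dI_eq => // s Is.
have [df _] := C1f; have W0 := Wn0 Is; have p0 := p1n0 Is.
rewrite (has_dIE Is (has_dI_div p0 (ddiff_has_dI (df s Is)) (has_dI_phi1 Is))) f2sE.
by field; rewrite W0 p0.
Qed.

(* Variation of constants: f = f1* phi1 + f2* phi2 and f' = f1* phi1' + f2* phi2'
   force phi1 D f1* + phi2 D f2* = 0. *)
Lemma has_dI_f1s t : I t -> ddiff T x0 f2 t ->
  has_dI T x0 f1 t (- (p2 t / p1 t * d f2 t)).
Proof.
move=> It d2; have [df _] := C1f; have p0 := p1n0 It.
apply: (has_dI_eq It (f := fun s => (f s - f2 s * p2 s) / p1 s)).
  by move=> s Is; rewrite (decomp_f Is) addrK mulfK// p1n0.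
have := has_dI_div p0 (has_dIB (ddiff_has_dI (df t It))
  (has_dIM (ddiff_has_dI d2) (has_dI_phi2 It))) (has_dI_phi1 It).
congr has_dI; rewrite (decomp_df It) (decomp_f It).
by field.
Qed.

Lemma dens_cvg0 u v : wr_gap u v t @[t --> toward x0] --> 0.
Proof.
have : u * (f2 t - a2) - v * (f1 t - a1) @[t --> toward x0] --> u * (a2 - a2) - v * (a1 - a1).
  apply: cvgB; apply: cvgM; try exact: cvg_cst.
    by apply: cvgB; [exact: cvg_toward_Df|exact: cvg_cst].
  by apply: cvgB; [exact: cvg_toward_Df|exact: cvg_cst].
by rewrite !subrr !mulr0 subrr.
Qed.

Lemma ACon_f1s : ACon T x0 f1.
Proof.
move=> x y Ix Iy xy; apply: AC_div.
- by move=> t xt ty; apply/Wn0/(Iset_ge Iy) => //; case: Ix => Tx _; lra.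
- by apply: ACon_Wr => //; exact: ACon_p2.
- by apply: ACon_Wr => //; [exact: ACon_p1|exact: ACon_p2].
Qed.

(* The integrands phi1 / W L[f], phi2 / W L[f] and Phi / W L[f] of the paper. *)
Definition potential u v t := lin_comb u v t / W t * Lf t.

Lemma measurable_potential u v x y : I x -> I y -> x <= y ->
  measurable_fun `[x, y] (potential u v).
Proof.
move=> Ix Iy xy.
apply: (@eq_measurable_fun _ _ _ _ _ (fun t => lin_comb u v t / p1 t * d f2 t)).
  move=> t; rewrite inE/= in_itv/= => /andP[xt ty].
  have It : I t by apply: (Iset_ge Iy) => //; case: Ix => Tx _; lra.
  rewrite /potential LopE//; have W0 := Wn0 It; have p0 := p1n0 It.
  by field; rewrite W0 p0.
apply: measurable_funM; last first.
  by apply: measurable_dI => //; exact: (ACon_continuous Ix Iy ACon_f2s).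
apply: subspace_continuous_measurable_fun => //; apply: AC_on_continuous.
apply: AC_div; [|exact: AC_comb|exact: ACon_p1].
by move=> t xt ty; apply/p1n0/(Iset_ge Iy) => //; case: Ix => Tx _; lra.
Qed.

Lemma iint_potential u v x : I x ->
  iint_ex x0 (potential u v) x /\ iint x0 (potential u v) x = - wr_gap u v x.
Proof.
move=> Ix; rewrite -sub0r.
have Ix0 y : x <= y -> (y%:E < x0)%E -> I y by exact: Iset_le.
apply: (iint_AC (G := wr_gap u v) Ix) => [y xy yx0|y xy yx0|y xy yx0|].
- have Iy := Ix0 y xy yx0.
  have ac_cst (c : R) : AC_on x y (fun=> c).
    by apply: (@AC_on_Lipschitz _ _ _ _ 0) => *; rewrite subrr normr0 mul0r.
  exact: AC_onB (AC_onZ u (AC_onB (ACon_f2s Ix Iy xy) (ac_cst a2)))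
    (AC_onZ v (AC_onB (ACon_f1s Ix Iy xy) (ac_cst a1))).
- by apply: measurable_potential; auto.
- have Iy := Ix0 y xy yx0.
  apply: filterS (ACon_ae_ddiff ACon_f2s Ix Iy xy) => t H xt ty.
  have It : I t by apply: (Iset_ge Iy); case: Ix => Tx _; lra.
  have d2 := H xt ty.
  have := has_dIB (has_dIZ (c := u) (has_dIB (ddiff_has_dI d2) (has_dI_cst _ _ a2 t)))
    (has_dIZ (c := v) (has_dIB (has_dI_f1s It d2) (has_dI_cst _ _ a1 t))).
  congr has_dI; rewrite /potential LopE// /lin_comb; have W0 := Wn0 It; have p0 := p1n0 It.
  by field; rewrite W0 p0.
- exact: dens_cvg0.
Qed.

(** The inner integral is - [wr_gap], so the iterated integral collapses to [ratio_formula] with -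
    c; no exchange of integrals occurs. *)
Lemma iint_iint_potential (c : R) (w : R -> R) u v x : I x ->
  (forall t, x <= t -> (t%:E < x0)%E -> lin_comb u v t != 0) ->
  (forall t, x <= t -> (t%:E < x0)%E -> w t = c * (W t / lin_comb u v t ^+ 2)) ->
  remainder t / lin_comb u v t @[t --> toward x0] --> 0 ->
  iint_ex x0 (fun t => w t * iint x0 (potential u v) t) x /\
  iint x0 (fun t => w t * iint x0 (potential u v) t) x = c * (remainder x / lin_comb u v x).
Proof.
move=> Ix c0 wE rc0; have [Tx xx0] := Ix.
have [ex eq] := ratio_formula (- c) Ix c0 rc0.
have [|ex' ->] := iint_eq xx0 _ ex (k := fun t => w t * iint x0 (potential u v) t).
  move=> t xt tx0; rewrite wE// (proj2 (iint_potential u v (Iset_le Ix xt tx0))).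
  by rewrite mulNr mulrN -!mulrA.
by split => //; rewrite eq mulNr opprK.
Qed.

(** The integral starts at [x] and not at [t], which gives one bound valid for all t >= x. *)
Lemma potential_bound u v x t : I x -> x <= t -> (t%:E < x0)%E ->
  (`|wr_gap u v t|%:E <= \int[mu]_(s in [set s : R | (x <= s)%R /\ (s%:E < x0)%E])
    `|potential u v s|%:E)%E.
Proof.
move=> Ix xt tx0; have It := Iset_le Ix xt tx0; have [ex eq] := iint_potential u v It.
rewrite -[wr_gap u v t]opprK -eq normrN; apply: (norm_iint_le Ix) => // y xy yx0.
by apply: measurable_potential => //; exact: Iset_le Ix xy yx0.
Qed.

End limit_tangent.

(** * Integral representations, estimates and mean values of the remainder *)

Theorem theorem5p3 (R : realType) (x0 : \bar R) (T : R)
    (phi1 phi2 f : R -> R) (a1 a2 : R) :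
  (T%:E < x0)%E ->
  C1on T x0 phi1 -> C1on T x0 phi2 ->
  phi2 =o_ (towardF x0) phi1 ->
  (forall x, Iset T x0 x -> phi1 x != 0) ->
  (forall x, Iset T x0 x -> phi2 x != 0) ->
  (forall x, Iset T x0 x -> Wr T x0 phi1 phi2 x != 0) ->
  ACon T x0 f ->
  f1s T x0 phi1 phi2 f @ within (Df T x0 f) (toward x0) --> a1 ->
  f2s T x0 phi1 phi2 f @ within (Df T x0 f) (toward x0) --> a2 ->
  let I := Iset T x0 in
  let Io := fun x : R => T < x /\ (x%:E < x0)%E in
  let W := Wr T x0 phi1 phi2 in
  let d := dI T x0 in
  let f2 := f2s T x0 phi1 phi2 f in
  let F := Fs T x0 phi1 phi2 f in
  let P := Phi T phi1 phi2 in
  let Lf := Lop T x0 phi1 phi2 f in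
  let gamma := lim (F @ within (Df T x0 f) (toward x0)) in
  let Rm := fun x => f x - a1 * phi1 x - a2 * phi2 x in
  let AC1 := AC1on T x0 phi1 /\ AC1on T x0 phi2 /\ AC1on T x0 f in
  let h1 := fun s => phi1 s / W s * Lf s in
  let h2 := fun s => phi2 s / W s * Lf s in
  let hP := fun s => P s / W s * Lf s in
  (* gamma exists *)
  (F @ within (Df T x0 f) (toward x0) --> gamma) /\
  (* (I) *)
  (forall x, I x ->
     iint_ex x0 (fun t => W t / phi1 t ^+ 2 * (f2 t - a2)) x /\
     Rm x = - phi1 x * iint x0 (fun t => W t / phi1 t ^+ 2 * (f2 t - a2)) x /\
     iint_ex x0 (fun t => d (fun s => phi2 s / phi1 s) t * (f2 t - a2)) x /\
     Rm x = - phi1 x * iint x0 (fun t => d (fun s => phi2 s / phi1 s) t * (f2 t - a2)) x) /\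
  (forall x, Io x ->
     iint_ex x0 (fun t => W t / P t ^+ 2 * (F t - gamma)) x /\
     Rm x = - P x * iint x0 (fun t => W t / P t ^+ 2 * (F t - gamma)) x) /\
  (AC1 ->
    (forall x, I x ->
       (forall t, x <= t -> (t%:E < x0)%E -> iint_ex x0 h1 t) /\
       iint_ex x0 (fun t => d (fun s => phi2 s / phi1 s) t * iint x0 h1 t) x /\
       Rm x = phi1 x * iint x0 (fun t => d (fun s => phi2 s / phi1 s) t * iint x0 h1 t) x) /\
    (forall x, I x ->
       (forall t, x <= t -> (t%:E < x0)%E -> iint_ex x0 h2 t) /\
       iint_ex x0 (fun t => d (fun s => phi1 s / phi2 s) t * iint x0 h2 t) x /\
       Rm x = - phi2 x * iint x0 (fun t => d (fun s => phi1 s / phi2 s) t * iint x0 h2 t) x) /\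
    (forall x, Io x ->
       (forall t, x <= t -> (t%:E < x0)%E -> iint_ex x0 hP t) /\
       iint_ex x0 (fun t => W t / P t ^+ 2 * iint x0 hP t) x /\
       Rm x = P x * iint x0 (fun t => W t / P t ^+ 2 * iint x0 hP t) x)) /\
  (* (II) *)
  (forall x, I x ->
     ((`|Rm x|)%:E <= (`|phi2 x|)%:E *
        ess_sup (@lebesgue_measure R)
          (fun t => if (x < t)%R && (t%:E < x0)%E then (`|f2 t - a2|)%:E else 0%E))%E /\
     ((`|Rm x|)%:E <= (`|phi2 x / phi2 T|)%:E *
        ess_sup (@lebesgue_measure R)
          (fun t => if (x < t)%R && (t%:E < x0)%E then (`|F t - gamma|)%:E else 0%E))%E) /\
  (AC1 ->
    (forall x, I x ->
      ((`|Rm x|)%:E <= (`|phi2 x|)%:E *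
        \int[@lebesgue_measure R]_(t in [set t : R | (x <= t)%R /\ (t%:E < x0)%E]) (`|h1 t|)%:E)%E) /\
    (forall x, Io x ->
      ((`|Rm x|)%:E <= (`|phi2 x / phi2 T|)%:E *
        \int[@lebesgue_measure R]_(t in [set t : R | (x <= t)%R /\ (t%:E < x0)%E]) (`|hP t|)%:E)%E)) /\
  (* (III) *)
  (C1on T x0 f ->
    (forall x, I x -> exists xi : \bar R, (x%:E <= xi <= x0)%E /\
        Rm x = phi2 x * (ext_val x0 f2 a2 xi - a2)) /\
    (forall x, Io x -> exists xi : \bar R, (x%:E <= xi <= x0)%E /\
        Rm x = phi2 x / phi2 T * (ext_val x0 F gamma xi - gamma))) /\
  (AC1 ->
    (forall x, Io x -> exists xi : \bar R, (x%:E <= xi <= x0)%E /\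
        Rm x = phi2 x * (ext_val x0 f2 a2 xi - a2) /\
        (forall r, xi = r%:E -> (r%:E < x0)%E -> iint_ex x0 h1 r) /\
        Rm x = - phi2 x * ext_val x0 (iint x0 h1) 0 xi) /\
    (forall x, Io x -> exists xi : \bar R, (x%:E <= xi <= x0)%E /\
        Rm x = phi2 x / phi2 T * (ext_val x0 F gamma xi - gamma) /\
        (forall r, xi = r%:E -> (r%:E < x0)%E -> iint_ex x0 hP r) /\
        Rm x = - (phi2 x / phi2 T) * ext_val x0 (iint x0 hP) 0 xi)).
Proof.
move=> Tx0 C1p1 C1p2 p21o p1n0 p2n0 Wn0 acf cf1 cf2 I Io W d f2 F P Lf gamma Rm AC1 h1 h2 hP.
have IoI x : Io x -> I x by move=> [Tx xx0]; split => //; exact: ltW.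
have Ile x t : I x -> x <= t -> (t%:E < x0)%E -> I t by exact: Iset_le.
have IT : I T by split.
have gE : gamma = phi1 T * a1 + phi2 T * a2 by exact: lim_Fs.
have P0 x : Io x -> P x != 0 by move=> [Tx xx0]; exact: (@Phi_neq0 _ T x0).
have Pn0 x t : Io x -> x <= t -> (t%:E < x0)%E -> P t != 0.
  by move=> [Tx _] xt tx0; apply: P0; split => //; exact: lt_le_trans xt.
pose cb := lin_comb phi1 phi2; pose dn := wr_gap T x0 phi1 phi2 f a1 a2.
pose pt := potential T x0 phi1 phi2 f.
have c1 : cb 1 0 = phi1 := lin_comb10 phi1 phi2.
have c2 : cb 0 1 = phi2 := lin_comb01 phi1 phi2.
have cP : cb (phi2 T) (- phi1 T) = P := lin_combP T phi1 phi2.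
have cV : cb 0 (phi2 T)^-1 = fun t => phi2 t / phi2 T := lin_comb0V T phi1 phi2.
have d1 t : dn 1 0 t = f2 t - a2 := wr_gap10 T x0 phi1 phi2 f a1 a2 t.
have dP t : dn (phi2 T) (- phi1 T) t = F t - gamma.
  by rewrite gE; exact: wr_gapP.
have r1 : Rm t / cb 1 0 t @[t --> toward x0] --> 0 by rewrite c1; exact: (@rem1_0 R T x0 phi1 phi2 f a1 a2).
have r2 : Rm t / cb 0 1 t @[t --> toward x0] --> 0 by rewrite c2; exact: (@rem2_0 R T x0 phi1 phi2 f a1 a2).
have rP : Rm t / cb (phi2 T) (- phi1 T) t @[t --> toward x0] --> 0.
  by rewrite cP; exact: (@remP_0 R T x0 phi1 phi2 f a1 a2).
have q1 : cb 0 1 t / cb 1 0 t @[t --> toward x0] --> 0.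
  by rewrite c1 c2; exact: (@ratio21_0 R T x0 phi1 phi2).
have qP : cb 0 (phi2 T)^-1 t / cb (phi2 T) (- phi1 T) t @[t --> toward x0] --> 0.
  by rewrite cV cP; exact: (@ratioP_0 R T x0 phi1 phi2).
have detP : phi2 T * (phi2 T)^-1 - - phi1 T * 0 = 1.
  by rewrite mulr0 subr0 divff// p2n0.
have det1 : 1 * 1 - 0 * 0 = 1 :> R by rewrite mulr1 mulr0 subr0.
have n1 x t : I x -> x <= t -> (t%:E < x0)%E -> cb 1 0 t != 0.
  by move=> Ix xt tx0; rewrite c1; apply/p1n0/Ile/tx0/xt.
have n2 x t : I x -> x <= t -> (t%:E < x0)%E -> cb 0 1 t != 0.
  by move=> Ix xt tx0; rewrite c2; apply/p2n0/Ile/tx0/xt.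
have nP x t : Io x -> x <= t -> (t%:E < x0)%E -> cb (phi2 T) (- phi1 T) t != 0.
  by move=> Ix xt tx0; rewrite cP; exact: Pn0 Ix xt tx0.
have dr21 t : I t -> d (fun s => phi2 s / phi1 s) t = W t / phi1 t ^+ 2.
  move=> It; apply: has_dIE => //.
  have := has_dI_div (p1n0 t It) (has_dI_phi2 C1p2 It) (has_dI_phi1 C1p1 It).
  by congr has_dI.
(* Exchanging phi1 and phi2 reverses the sign of the Wronskian, whence the minus sign in the phi2
   formula. *)
have dr12 t : I t -> d (fun s => phi1 s / phi2 s) t = -1 * (W t / phi2 t ^+ 2).
  move=> It; apply: has_dIE => //.
  have := has_dI_div (p2n0 t It) (has_dI_phi1 C1p1 It) (has_dI_phi2 C1p2 It).
  by congr has_dI; rewrite mulrA; congr (_ / _); rewrite /W /Wr; ring.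
(* The integrand [w] is prescribed only on [x, x0), which covers both the form with W/phi1^2 and the
   one with the derivative of phi2/phi1. *)
have fm u v w x : I x -> (forall t, x <= t -> (t%:E < x0)%E -> cb u v t != 0) ->
    Rm t / cb u v t @[t --> toward x0] --> 0 ->
    (forall t, x <= t -> (t%:E < x0)%E -> w t = W t / cb u v t ^+ 2 * dn u v t) ->
    iint_ex x0 w x /\ Rm x = - cb u v x * iint x0 w x.
  move=> Ix cn0 rc0 wE; have [Tx xx0] := Ix.
  have [ex eq] := ratio_formula C1p1 C1p2 Wn0 acf 1 Ix cn0 rc0.
  have [|ex' ->] := iint_eq xx0 _ ex (k := w).
    by move=> t xt tx0; rewrite mul1r wE.
  split => //; rewrite eq mul1r mulrNN mulrC divfK//; exact: cn0.
have fm1 x w : I x ->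
    (forall t, x <= t -> (t%:E < x0)%E -> w t = W t / phi1 t ^+ 2 * (f2 t - a2)) ->
    iint_ex x0 w x /\ Rm x = - phi1 x * iint x0 w x.
  move=> Ix wE; have [||] := fm 1 0 w x Ix _ r1; last by rewrite c1.
  - by move=> t; exact: n1 Ix.
  - by move=> t xt tx0; rewrite c1 d1 wE.
have mean1 : C1on T x0 f -> forall x, I x -> exists t,
    [/\ x < t, (t%:E < x0)%E & Rm x = phi2 x * (f2 t - a2)].
  move=> C1f x Ix; have nn t := n1 x t Ix.
  have [|t [xt tx0 E]] := ratio_mean C1p1 C1p2 Wn0 acf C1f Ix det1 nn _ r1 q1.
    by rewrite -/cb c2 p2n0.
  have {}E : Rm x = cb 0 1 x * dn 1 0 t := E.
  by exists t; split => //; rewrite E c2 d1.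
have meanP : C1on T x0 f -> forall x, Io x -> exists t,
    [/\ x < t, (t%:E < x0)%E & Rm x = phi2 x / phi2 T * (F t - gamma)].
  move=> C1f x Iox; have Ix := IoI x Iox; have nn t := nP x t Iox.
  have [|t [xt tx0 E]] := ratio_mean C1p1 C1p2 Wn0 acf C1f Ix detP nn _ rP qP.
    by rewrite -/cb cV mulf_neq0 ?invr_eq0 ?p2n0.
  have {}E : Rm x = cb 0 (phi2 T)^-1 x * dn (phi2 T) (- phi1 T) t := E.
  by exists t; split => //; rewrite E cV dP.
have pt1 : pt 1 0 = h1 by apply/funext => s; rewrite /pt /potential -/cb c1.
have pt2 : pt 0 1 = h2 by apply/funext => s; rewrite /pt /potential -/cb c2.
have ptP : pt (phi2 T) (- phi1 T) = hP.
  by apply/funext => s; rewrite /pt /potential -/cb cP.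
have ip u v x : AC1 -> I x -> iint_ex x0 (pt u v) x /\ iint x0 (pt u v) x = - dn u v x.
  by move=> [[_ ac1] [[_ ac2] [C1f acdf]]] Ix; exact: iint_potential.
have iip c w u v x : AC1 -> I x ->
    (forall t, x <= t -> (t%:E < x0)%E -> cb u v t != 0) ->
    (forall t, x <= t -> (t%:E < x0)%E -> w t = c * (W t / cb u v t ^+ 2)) ->
    Rm t / cb u v t @[t --> toward x0] --> 0 ->
    iint_ex x0 (fun t => w t * iint x0 (pt u v) t) x /\
    iint x0 (fun t => w t * iint x0 (pt u v) t) x = c * (Rm x / cb u v x).
  by move=> [[_ ac1] [[_ ac2] [C1f acdf]]] Ix cn0 wE rc0; exact: iint_iint_potential.
have pb u v x t : AC1 -> I x -> x <= t -> (t%:E < x0)%E ->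
    (`|dn u v t|%:E <= \int[@lebesgue_measure R]_(s in
       [set s : R | (x <= s)%R /\ (s%:E < x0)%E]) `|pt u v s|%:E)%E.
  by move=> [[_ ac1] [[_ ac2] [C1f acdf]]] Ix xt tx0; exact: potential_bound.
have int0 u v x : (0 <= \int[@lebesgue_measure R]_(s in
       [set s : R | (x <= s)%R /\ (s%:E < x0)%E]) `|pt u v s|%:E)%E.
  by apply: integral_ge0 => s _; rewrite lee_fin.
have ratio_gt0 x : I x -> 0 < `|phi2 x / phi2 T|.
  by move=> Ix; rewrite normr_gt0 mulf_neq0 ?invr_eq0 ?p2n0.
split; first by rewrite gE; exact: (@cvg_Fs R T x0 phi1 phi2 f a1 a2).
split.
  move=> x Ix; have [ea ra] := fm1 x _ Ix (fun _ _ _ => erefl).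
  split; [exact: ea|split; [exact: ra|]]; apply: fm1; first exact: Ix.
  by move=> t xt tx0; rewrite dr21//; exact: Ile Ix xt tx0.
split.
  move=> x Iox; have Ix := IoI x Iox; rewrite -cP.
  apply: (fm _ _ _ x Ix _ rP) => t xt tx0; first exact: nP Iox xt tx0.
  by rewrite dP.
split.
  move=> hAC; split; [|split].
  - move=> x Ix; split.
      by move=> t xt tx0; rewrite -pt1; have [] := ip 1 0 t hAC (Ile x t Ix xt tx0).
    rewrite -pt1; have [||ex ->] := iip 1 (d (fun s => phi2 s / phi1 s)) 1 0 x hAC Ix _ _ r1.
    + by move=> t; exact: n1 Ix.
    + by move=> t xt tx0; rewrite c1 mul1r dr21//; exact: Ile Ix xt tx0.
    by split => //; rewrite c1 mul1r mulrC divfK// p1n0.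
  - move=> x Ix; split.
      by move=> t xt tx0; rewrite -pt2; have [] := ip 0 1 t hAC (Ile x t Ix xt tx0).
    rewrite -pt2; have [||ex ->] := iip (-1) (d (fun s => phi1 s / phi2 s)) 0 1 x hAC Ix _ _ r2.
    + by move=> t; exact: n2 Ix.
    + by move=> t xt tx0; rewrite c2 dr12//; exact: Ile Ix xt tx0.
    by split => //; rewrite c2 mulN1r mulrNN mulrC divfK// p2n0.
  - move=> x Iox; have Ix := IoI x Iox; split.
      move=> t xt tx0; rewrite -ptP.
      by have [] := ip (phi2 T) (- phi1 T) t hAC (Ile x t Ix xt tx0).
    rewrite -ptP; have [||ex ->] := iip 1 (fun t => W t / P t ^+ 2) _ _ x hAC Ix _ _ rP.
    + by move=> t; exact: nP Iox.
    + by move=> t xt tx0; rewrite cP mul1r.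
    by split => //; rewrite cP mul1r mulrC divfK// P0.
split.
  move=> x Ix; have [Tx xx0] := Ix; split.
    apply: ess_sup_bound => //; first by rewrite normr_gt0 p2n0.
    move=> M M0 HM; apply: (@rem_bound1 R T x0 phi1 phi2 f a1 a2) => // y xy yx0.
    apply: filterS HM => t HM xt ty _; apply: HM => //.
    by apply: lt_trans yx0; rewrite lte_fin.
  apply: ess_sup_bound => //; first exact: ratio_gt0.
  move=> M M0 HM; apply: (@rem_boundP R T x0 phi1 phi2 f a1 a2) => //.
  by apply: filterS HM => t HM xt tx0 _; rewrite -gE; exact: HM.
split.
  move=> hAC; split.
    move=> x Ix; apply: lee_mul_bound; first by rewrite normr_gt0 p2n0.
      by rewrite -pt1; exact: int0.
    (* The value of the integral over [x, x0) bounds f2* - a2 at every later point and serves as the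
       constant [M]. *)
    move=> M EM; have dM t : x <= t -> (t%:E < x0)%E -> `|f2 t - a2| <= M.
      by move=> xt tx0; rewrite -lee_fin -EM -d1 -pt1; exact: pb.
    apply: (@rem_bound1 R T x0 phi1 phi2 f a1 a2) => //; first by rewrite -lee_fin -EM -pt1; exact: int0.
    move=> y xy yx0; apply: nearW => t xt ty _; apply: dM; first exact: ltW.
    by apply: lt_trans yx0; rewrite lte_fin.
  move=> x Iox; have Ix := IoI x Iox; apply: lee_mul_bound; first exact: ratio_gt0.
    by rewrite -ptP; exact: int0.
  move=> M EM; apply: (@rem_boundP R T x0 phi1 phi2 f a1 a2) => //; first by rewrite -lee_fin -EM -ptP; exact: int0.
  apply: nearW => t xt tx0 _; rewrite -gE -dP -lee_fin -EM -ptP.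
  by apply: pb => //; exact: ltW.
split.
  move=> C1f; split => [x Ix|x Iox].
    (* Rolle's theorem yields a point strictly below x0, so [ext_val] returns the function value and
       not its default. *)
    have [t [xt tx0 E]] := mean1 C1f x Ix; exists t%:E.
      by rewrite /ext_val tx0 lee_fin (ltW xt) (ltW tx0); split.
  have [t [xt tx0 E]] := meanP C1f x Iox; exists t%:E.
  by rewrite /ext_val tx0 lee_fin (ltW xt) (ltW tx0); split.
move=> hAC; have [_ [_ [C1f _]]] := hAC; split => x Iox; have Ix := IoI x Iox.
  have [t [xt tx0 E]] := mean1 C1f x Ix; exists t%:E.
  have It := Ile x t Ix (ltW xt) tx0; have [ex eq] := ip 1 0 t hAC It.
  rewrite /ext_val tx0 lee_fin (ltW xt) (ltW tx0); split; [by []|split; [exact: E|split]].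
    by move=> r [<-] _; rewrite -pt1.
  by rewrite -pt1 eq d1 mulrNN.
have [t [xt tx0 E]] := meanP C1f x Iox; exists t%:E.
have It := Ile x t Ix (ltW xt) tx0; have [ex eq] := ip (phi2 T) (- phi1 T) t hAC It.
rewrite /ext_val tx0 lee_fin (ltW xt) (ltW tx0); split; [by []|split; [exact: E|split]].
  by move=> r [<-] _; rewrite -ptP.
by rewrite -ptP eq dP mulrNN.
Qed.
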